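(* Let $\mathbb{X}$ and $\mathbb{Y}$ be Hilbert spaces, $\Omega\subseteq\mathbb{X}$ an open set and $F:\Omega\to\mathbb{Y}$ a continuously differentiable function such that $F'(x)$ has closed image for every $x\in\Omega$. Let $x_*\in\Omega$, $R>0$, $\beta:=\|F'(x_* )^{\dagger}\|$ and $\kappa:=\sup\{t\in[0,R): B(x_*,t)\subset\Omega\}$. Suppose that $F(x_* )=0$, that $F'(x_* )$ is injective, and that there exist constants $K>0$ and $0<p\le1$ such that $$\beta\|F'(x)-F'(x_*+\tau(x-x_* ))\|\le K(1-\tau^p)\|x-x_*\|^p,\qquad x\in B(x_*,\kappa),\ \tau\in[0,1].$$ Take $0\le\vartheta<1$ and $0\le\omega_2<\omega_1$ such that $\omega_1\vartheta+\omega_2<1$. Let $$r=\min\left\{\kappa,\left[\frac{(1-\omega_1\vartheta-\omega_2)(p+1)}{K(1-\omega_1\vartheta-\omega_2+p(1+\omega_1-\omega_2))}\right]^{1/p}\right\}.$$ Consider the inexact Gauss-Newton like method with initial point $x_0\in B(x_*,r)\setminus\{x_*\}$ defined by $$x_{k+1}=x_k+S_k,\qquad B(x_k)S_k=-F'(x_k)^*F(x_k)+r_k,\qquad k=0,1,\ldots,$$ where $B(x_k)$ is an invertible approximation of $F'(x_k)^*F'(x_k)$ satisfying $$\|B(x_k)^{-1}F'(x_k)^*F'(x_k)\|\le\omega_1,\qquad \|B(x_k)^{-1}F'(x_k)^*F'(x_k)-I\|\le\omega_2,\qquad k=0,1,\ldots,$$ and the residual $r_k\in\mathbb{X}$, the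 forcing term $\theta_k$ and the invertible preconditioner $P_k$ are such that $$\|P_kr_k\|\le\theta_k\|P_kF'(x_k)^*F(x_k)\|,\qquad 0\le\theta_k\,\mathrm{cond}(P_kF'(x_k)^*F'(x_k))\le\vartheta,\qquad k=0,1,\ldots.$$ Define the scalar sequence $\{t_k\}$ by $t_0=\|x_0-x_*\|$ and $$t_{k+1}=\frac{(1+\vartheta)\omega_1\,p\,K\,t_k^{p+1}}{(p+1)[1-K t_k^p]}+(\omega_1\vartheta+\omega_2)t_k,\qquad k=0,1,\ldots.$$ Then the sequences $\{x_k\}$ and $\{t_k\}$ are well defined; $\{t_k\}$ is strictly decreasing, contained in $(0,r)$ and converges to $0$. Furthermore, $\{x_k\}$ is contained in $B(x_*,r)$, converges to $x_*$, $$\|x_{k+1}-x_*\|\le\frac{(1+\vartheta)\omega_1\,p\,K}{(p+1)[1-K\|x_0-x_*\|^p]}\|x_k-x_*\|^{p+1}+(\omega_1\vartheta+\omega_2)\|x_k-x_*\|,\qquad k=0,1,\ldots,$$ and $\|x_k-x_*\|\le t_k$ for all $k=0,1,\ldots$.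
   Context: Hilbert spaces are real or complex. $B(a,\delta)=\{x\in\mathbb{X}:\|x-a\|<\delta\}$ is the open ball. $A^*$ denotes the adjoint of a continuous linear operator $A$. For a continuous injective linear operator $A:\mathbb{X}\to\mathbb{Y}$ with closed image, $A^{\dagger}:=(A^*A)^{-1}A^*$ is its Moore-Penrose inverse. For an invertible continuous linear operator $A$, $\mathrm{cond}(A):=\|A^{-1}\|\|A\|$. The operators $B(x_k)$ and $P_k$ are invertible continuous linear operators $\mathbb{X}\to\mathbb{X}$ (''approximation'' has no meaning beyond the stated inequalities); $I$ is the identity of $\mathbb{X}$; the $\theta_k$ are real numbers. Well-definedness of $\{x_k\}$ includes that each $F'(x_k)^*F'(x_k)$ is invertible and each iterate stays in $\Omega$. *)

(* Defs.v *)
From HB Require Import structures.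
From mathcomp Require Import all_boot all_order all_algebra.
From mathcomp Require Import complex.
From mathcomp Require Import all_classical all_reals all_analysis.

Set Implicit Arguments.
Unset Strict Implicit.
Unset Printing Implicit Defensive.

Import Order.TTheory GRing.Theory Num.Theory.
Import numFieldNormedType.Exports.
Local Open Scope classical_set_scope.
Local Open Scope ring_scope.

Variant scalar_kind := RealScalars | ComplexScalars.

Definition scalars (R : realType) (k : scalar_kind) : numFieldType :=
  match k with
  | RealScalars => R : numFieldType
  | ComplexScalars => R[i] : numFieldType
  end.

Definition scal_conj (R : realType) (k : scalar_kind) :
    scalars R k -> scalars R k :=
  match k return scalars R k -> scalars R k with
  | RealScalars => fun z => z
  | ComplexScalars => @conjc R
  end.

Definition scal_re (R : realType) (k : scalar_kind) : scalars R k -> R :=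
  match k return scalars R k -> R with
  | RealScalars => fun z => z
  | ComplexScalars => @complex.Re R
  end.

Definition scal_real (R : realType) (k : scalar_kind) : R -> scalars R k :=
  match k return R -> scalars R k with
  | RealScalars => fun a => a
  | ComplexScalars => fun a => Complex a 0
  end.

(* A Hilbert space over R or R[i]: a Banach space whose norm comes from an
   inner product, linear in its first argument and conjugate-linear in the
   second. *)
Record hilbertSpace (R : realType) (k : scalar_kind) := HilbertSpace {
  hilbert_sort :> completeNormedModType (scalars R k);
  hdot : {dot hilbert_sort for @scal_conj R k};
  hdot_norm : forall x : hilbert_sort, `|x| ^+ 2 = hdot x x
}.

(* The library norm takes its values in the scalar field; rnorm is the same
   number seen in R. *)
Definition rnorm (R : realType) (k : scalar_kind) (X : hilbertSpace R k)
  (x : X) : R := scal_re `|x|.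

Definition oball (R : realType) (k : scalar_kind) (X : hilbertSpace R k)
  (a : X) (d : R) : set X := [set x | rnorm (x - a) < d].

Section Operators.
Context (R : realType) (k : scalar_kind).
Implicit Types X Y : hilbertSpace R k.

Definition continuous_linear X Y (A : X -> Y) : Prop :=
  linear A /\ continuous A.

Definition invertible_op X Y (A : X -> Y) : Prop :=
  continuous_linear A /\
  exists G : Y -> X, [/\ continuous_linear G, cancel A G & cancel G A].

(* Total function; it is the inverse of A when A is bijective. *)
Definition invop X Y (A : X -> Y) : Y -> X := 'pinv_(fun=> 0) [set: X] A.

(* Meaningful for bounded linear A. *)
Definition opnorm X Y (A : X -> Y) : R :=
  sup [set rnorm (A v) | v in [set v : X | rnorm v <= 1]].

(* At each y, the vector representing x |-> <A x, y>; it is unique, and exists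
   by the Riesz theorem when A is continuous and linear. *)
Definition adjoint X Y (A : X -> Y) : Y -> X :=
  fun y => xget 0 [set z : X | forall x : X, hdot Y (A x) y = hdot X x z].

Definition normal_op X Y (A : X -> Y) : X -> X := adjoint A \o A.

(* Used for A continuous, linear and injective with closed image. *)
Definition mp_inverse X Y (A : X -> Y) : Y -> X :=
  invop (normal_op A) \o adjoint A.

Definition condn X Y (A : X -> Y) : R := opnorm (invop A) * opnorm A.

(* Used on an open set Om, so that the limit below does not depend on the
   values of F outside Om. *)
Definition continuously_differentiable_on X Y (Om : set X) (F : X -> Y) : Prop :=
  forall x : X, Om x -> differentiable F x /\
    (opnorm (fun v : X => 'd F y v - 'd F x v) @[y --> x] --> (0 : R)).

(* The points from which a Gauss-Newton step can be performed. *)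
Definition admissible X Y (Om : set X) (F : X -> Y) (x : X) : Prop :=
  Om x /\ invertible_op (normal_op ('d F x)).

End Operators.

(* Main.v *)
Require Import Defs.
From HB Require Import structures.
From mathcomp Require Import all_boot all_order all_algebra.
From mathcomp Require Import complex.
From mathcomp Require Import all_classical all_reals all_analysis.
From mathcomp Require Import ring lra.

(* Write e = x_k - xs, A = F'(x_k), N = A^* A and E = A e - F(x_k). One step reads
     x_{k+1} - xs = - (B^-1 N e - e) + B^-1 N A^+ E + B^-1 N (P N)^-1 (P r),
   so its norm is at most (w1 vtheta + w2) |e| + (1 + vtheta) w1 |A^+ E|.
   The radial Holder condition at tau = 0 makes A bounded below with constant
   beta / (1 - K |e|^p), which bounds A^+; integrated along the segment from xs
   to x_k it bounds beta |E| by K p / (p + 1) |e|^(p+1). The error is therefore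
   majorized by the scalar sequence t, whose ratios t_{k+1} / t_k stay below a
   constant < 1 inside the given radius.
   That |v| <= beta |F'(xs) v| is the bounded inverse theorem; it is obtained
   from a gliding hump argument for the adjoint. All Hilbert space geometry is
   done with the real inner product Re <x, y>. *)

Set Implicit Arguments.
Unset Strict Implicit.
Unset Printing Implicit Defensive.

Import Order.TTheory GRing.Theory Num.Theory.
Import numFieldNormedType.Exports.
Local Open Scope classical_set_scope.
Local Open Scope ring_scope.

(** * The reals inside the scalar field, treated uniformly for both kinds *)

Section Scalars.
Context (R : realType) (sk : scalar_kind).
Implicit Types (a b : R) (z w : scalars R sk).

Lemma scal_realK a : scal_re (scal_real sk a) = a.
Proof. by case: sk. Qed.

Lemma scal_realD a b : scal_real sk (a + b) = scal_real sk a + scal_real sk b.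
Proof. by case: sk => //=; rewrite -[RHS]/(Complex _ _) addr0. Qed.

Lemma scal_realN a : scal_real sk (- a) = - scal_real sk a.
Proof. by case: sk => //=; rewrite -[RHS]/(Complex _ _) oppr0. Qed.

Lemma scal_real0 : scal_real sk (0 : R) = 0.
Proof. by case: sk. Qed.

Lemma scal_real1 : scal_real sk (1 : R) = 1.
Proof. by case: sk. Qed.

Lemma scal_reD z w : scal_re (z + w) = scal_re z + scal_re w.
Proof. by case: sk z w => //= -[? ?] [? ?]. Qed.

Lemma scal_reMl a z : scal_re (scal_real sk a * z) = a * scal_re z.
Proof. by case: sk z => //= -[x y] /=; rewrite mul0r subr0. Qed.

Lemma scal_realM a b : scal_real sk (a * b) = scal_real sk a * scal_real sk b.
Proof.
by case: sk => //=; rewrite -[RHS]/(Complex _ _) !mul0r !mulr0 !addr0 subr0.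
Qed.

Lemma scal_re_conj z : scal_re (scal_conj z) = scal_re z.
Proof. by case: sk z => //= -[]. Qed.

Lemma ler_scal_real a b : (scal_real sk a <= scal_real sk b) = (a <= b).
Proof. by case: sk => //=; rewrite lecE /= eqxx. Qed.

Lemma ltr_scal_real a b : (scal_real sk a < scal_real sk b) = (a < b).
Proof. by case: sk => //=; rewrite ltcE /= eqxx. Qed.

Lemma ge0_scal_realE z : 0 <= z -> z = scal_real sk (scal_re z).
Proof.
by case: sk z => //= -[x y]; rewrite lecE /= => /andP[/eqP->].
Qed.

Lemma norm_scal_real a : `|scal_real sk a| = scal_real sk `|a|.
Proof.
case: sk => //=; have [a0|a0] := leP 0 a.
  by rewrite !ger0_norm// lecE /= eqxx.
rewrite !ltr0_norm// ?ltcE /= ?eqxx//.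
by rewrite -[LHS]/(Complex _ _) oppr0.
Qed.

End Scalars.

(** * Topology, limits and completeness in terms of the real-valued norm *)

Section Norm.
Context (R : realType) (sk : scalar_kind) (X : hilbertSpace R sk).
Implicit Types (x y z : X) (a b d : R) (c : scalars R sk).

Lemma normE x : `|x| = scal_real sk (rnorm x).
Proof. exact/ge0_scal_realE. Qed.

Lemma rnorm_ge0 x : 0 <= rnorm x.
Proof. by rewrite -(ler_scal_real sk) -normE scal_real0. Qed.

Lemma rnorm0 : rnorm (0 : X) = 0.
Proof. by rewrite /rnorm normr0 -(scal_real0 R sk) scal_realK. Qed.

Lemma rnorm_eq0 x : rnorm x = 0 -> x = 0.
Proof. by move=> x0; apply/normr0_eq0; rewrite normE x0 scal_real0. Qed.

Lemma rnorm_gt0 x : x <> 0 -> 0 < rnorm x.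
Proof.
move=> x0; rewrite lt_neqAle rnorm_ge0 andbT eq_sym.
by apply/eqP => /rnorm_eq0.
Qed.

Lemma rnormN x : rnorm (- x) = rnorm x.
Proof. by rewrite /rnorm normrN. Qed.

Lemma rnormC x y : rnorm (x - y) = rnorm (y - x).
Proof. by rewrite -rnormN opprB. Qed.

Lemma ler_rnormD x y : rnorm (x + y) <= rnorm x + rnorm y.
Proof. by rewrite -(ler_scal_real sk) scal_realD -!normE ler_normD. Qed.

Lemma ler_rnormB x y : rnorm (x - y) <= rnorm x + rnorm y.
Proof. by rewrite (le_trans (ler_rnormD _ _))// rnormN. Qed.

Lemma rnormZ a x : rnorm (scal_real sk a *: x) = `|a| * rnorm x.
Proof. by rewrite /rnorm normrZ norm_scal_real scal_reMl. Qed.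

Lemma nbhs_oballP x (U : set X) :
  nbhs x U <-> exists2 d : R, 0 < d & oball x d `<=` U.
Proof.
split=> [/nbhs_normP[e /= e0 eU]|[d d0 dU]].
  exists (scal_re e).
    by rewrite -(ltr_scal_real sk) scal_real0 -ge0_scal_realE// ltW.
  move=> y xy; apply: eU => /=.
  rewrite distrC normE (ge0_scal_realE (ltW e0)) ltr_scal_real.
  exact: xy.
apply/nbhs_normP; exists (scal_real sk d).
  by rewrite /= -(scal_real0 R sk) ltr_scal_real.
move=> y /=; rewrite distrC normE ltr_scal_real => xy.
exact: dU.
Qed.

Lemma cvg_rnormP (T : Type) (F : set_system T) (f : T -> X) x : Filter F ->
  (f @ F --> x) <-> (forall d, 0 < d -> \forall t \near F, rnorm (f t - x) < d).
Proof.
move=> FF; split=> [fx d d0|fx U /nbhs_oballP[d d0 dU]].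
  by have /fx : nbhs x (oball x d) by apply/nbhs_oballP; exists d.
by apply: (filterS _ (fx d d0)) => t; exact: dU.
Qed.

Lemma cvg_rnorm (T : Type) (F : set_system T) (f : T -> X) x : Filter F ->
  (f @ F --> x) -> rnorm (f t) @[t --> F] --> rnorm x.
Proof.
move=> FF fx; apply/cvgrPdist_lt => e e0.
apply: filterS ((cvg_rnormP f x FF).1 fx e e0) => t; apply: le_lt_trans.
have := ler_rnormD (x - f t) (f t); rewrite subrK => H1.
have := ler_rnormD (f t - x) x; rewrite subrK => H2.
by rewrite (rnormC x) in H1; rewrite ler_norml; apply/andP; split; lra.
Qed.

Lemma cauchy_rnorm_cvg (u : nat -> X) :
  (forall d, 0 < d -> exists N, forall m n, (N <= m)%N -> (N <= n)%N ->
     rnorm (u m - u n) < d) -> exists x, u @ \oo --> x.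
Proof.
move=> uC; suff /cauchy_cvg : cauchy (u @ \oo) by move/cvg_ex.
apply: cauchy_exP => e /= e0.
have d0 : 0 < scal_re e.
  by rewrite -(ltr_scal_real sk) scal_real0 -ge0_scal_realE// ltW.
have [N uN] := uC _ d0; exists (u N), N => // n /= Nn.
rewrite -ball_normE /ball_ /= (ge0_scal_realE (ltW e0)) normE ltr_scal_real.
exact: uN.
Qed.

Lemma rnorm_le_cvg x (u : nat -> X) C : 
  (forall n, rnorm (u n - x) <= C) -> forall l, u @ \oo --> l ->
  rnorm (l - x) <= C.
Proof.
move=> uC l ul.
have : (fun n => u n - x) @ \oo --> l - x by apply: cvgB => //; exact: cvg_cst.
move/cvg_rnorm/cvgr_to_le; apply; exact: nearW.
Qed.

End Norm.

(** * Geometry of the real inner product *)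

Section RealDot.
Context (R : realType) (sk : scalar_kind).
Implicit Types (X Y : hilbertSpace R sk) (a : R).

Definition rdot X (x y : X) : R := scal_re (hdot X x y).

Lemma rdotDl X (x y z : X) : rdot (x + y) z = rdot x z + rdot y z.
Proof. by rewrite /rdot linearDl scal_reD. Qed.

Lemma rdotC X (x y : X) : rdot x y = rdot y x.
Proof.
by rewrite /rdot hermitian_subproof expr0 mul1r scal_re_conj.
Qed.

Lemma rdotZl X a (x y : X) : rdot (scal_real sk a *: x) y = a * rdot x y.
Proof. by rewrite /rdot linearZl_LR scal_reMl. Qed.

Lemma rdotDr X (x y z : X) : rdot x (y + z) = rdot x y + rdot x z.
Proof. by rewrite rdotC rdotDl !(rdotC x). Qed.

Lemma rdotZr X a (x y : X) : rdot x (scal_real sk a *: y) = a * rdot x y.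
Proof. by rewrite rdotC rdotZl rdotC. Qed.

Lemma rdotNl X (x y : X) : rdot (- x) y = - rdot x y.
Proof.
by rewrite -scaleN1r -(scal_real1 R) -scal_realN rdotZl mulN1r.
Qed.

Lemma rdotNr X (x y : X) : rdot x (- y) = - rdot x y.
Proof. by rewrite rdotC rdotNl rdotC. Qed.

Lemma rdotBl X (x y z : X) : rdot (x - y) z = rdot x z - rdot y z.
Proof. by rewrite rdotDl rdotNl. Qed.

Lemma rdotBr X (x y z : X) : rdot x (y - z) = rdot x y - rdot x z.
Proof. by rewrite rdotDr rdotNr. Qed.

Lemma rdotxx X (x : X) : rdot x x = rnorm x ^+ 2.
Proof.
by rewrite /rdot -hdot_norm normE expr2 -scal_realM scal_realK -expr2.
Qed.

(** For nonzero vectors, the squared norm of |x| y - |y| x expands to 2 |x| |y| (|x| |y| - Re <x,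
    y>). *)
Lemma rdot_CauchySchwarz X (x y : X) : rdot x y <= rnorm x * rnorm y.
Proof.
have [/eqP/rnorm_eq0->|x0] := boolP (rnorm x == 0).
  by rewrite -(scale0r (0 : X)) -(scal_real0 R sk) rdotZl rnormZ normr0 !mul0r.
have [/eqP/rnorm_eq0->|y0] := boolP (rnorm y == 0).
  by rewrite -(scale0r (0 : X)) -(scal_real0 R sk) rdotZr rnormZ normr0 !mul0r mulr0.
have {x0} xgt0 : 0 < rnorm x by rewrite lt_neqAle eq_sym x0 rnorm_ge0.
have {y0} ygt0 : 0 < rnorm y by rewrite lt_neqAle eq_sym y0 rnorm_ge0.
have := sqr_ge0 (rnorm (scal_real sk (rnorm x) *: y -
                        scal_real sk (rnorm y) *: x)).
rewrite -rdotxx rdotBl !rdotBr !rdotZl !rdotZr !rdotxx (rdotC y x) => H.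
have : 0 <= 2 * (rnorm x * rnorm y) * (rnorm x * rnorm y - rdot x y) by lra.
by rewrite pmulr_rge0 ?subr_ge0// !mulr_gt0.
Qed.

Lemma rnorm_parallelogram X (x y : X) :
  rnorm (x + y) ^+ 2 + rnorm (x - y) ^+ 2 = 2 * (rnorm x ^+ 2 + rnorm y ^+ 2).
Proof.
by rewrite -!rdotxx rdotBl rdotDl !rdotBr !rdotDr (rdotC y x); ring.
Qed.

End RealDot.

(* The real part of a sesquilinear form determines it: its imaginary part at x
   is minus its real part at 'i x. *)
Lemma rdot_hdot (R : realType) (sk : scalar_kind) (X Y : hilbertSpace R sk)
    (A : X -> Y) (y : Y) (z : X) : linear A ->
  (forall x, rdot (A x) y = rdot x z) -> forall x, hdot Y (A x) y = hdot X x z.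
Proof.
case: sk X Y A y z => X Y A y z linA Ayz x; first exact: Ayz.
apply/eqP; rewrite eq_complex; apply/andP; split; first exact/eqP/Ayz.
have := Ayz ('i%C *: x).
have -> : A ('i%C *: x) = 'i%C *: A x.
  by have := linA 'i%C x 0; rewrite !addr0 => ->; have := linA (-1) 0 0;
    rewrite scaler0 addr0 scaleN1r addNr => ->; rewrite addr0.
rewrite /rdot !linearZl_LR /=; case: (hdot Y _ _) (hdot X _ _) => [a b] [c d] /=.
by rewrite !mul0r !mul1r !sub0r => /oppr_inj ->.
Qed.

(** * Bounded linear operators and the operator norm *)

Section BoundedOperators.
Context (R : realType) (sk : scalar_kind).
Implicit Types (X Y Z : hilbertSpace R sk).

Lemma linear_fun0 X Y (A : X -> Y) : linear A -> A 0 = 0.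
Proof.
by move=> linA; have := linA (-1) 0 0; rewrite scaler0 addr0 scaleN1r addNr.
Qed.

Lemma linear_funZ X Y (A : X -> Y) : linear A ->
  forall a v, A (a *: v) = a *: A v.
Proof.
by move=> linA a v; have := linA a v 0; rewrite !addr0 linear_fun0// addr0.
Qed.

Lemma linear_funD X Y (A : X -> Y) : linear A ->
  forall u v, A (u + v) = A u + A v.
Proof. by move=> linA u v; have := linA 1 u v; rewrite !scale1r. Qed.

Lemma linear_funN X Y (A : X -> Y) : linear A -> forall v, A (- v) = - A v.
Proof. by move=> linA v; rewrite -scaleN1r linear_funZ// scaleN1r. Qed.

Lemma linear_funB X Y (A : X -> Y) : linear A ->
  forall u v, A (u - v) = A u - A v.
Proof. by move=> linA u v; rewrite linear_funD// linear_funN. Qed.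

Definition norm_bound X Y (A : X -> Y) (C : R) :=
  forall v, rnorm (A v) <= C * rnorm v.

Lemma continuous_linear_norm_bound X Y (A : X -> Y) : continuous_linear A ->
  exists2 C, 0 <= C & norm_bound A C.
Proof.
move=> [linA /(_ 0) contA].
have /contA/nbhs_oballP[d d0 dA] : nbhs (A 0) (oball (A 0) 1).
  by apply/nbhs_oballP; exists 1.
(* The ball of radius [d] is mapped into the unit ball; rescaling [v] to norm d / 2 produces the
   factor 2 / d. *)
exists (2 / d); first by rewrite divr_ge0// ltW.
move=> v; have [->|/eqP/rnorm_gt0 v0] := eqVneq v 0.
  by rewrite linear_fun0// !rnorm0 mulr0.
have /dA : oball 0 d (scal_real sk (d / 2 / rnorm v) *: v).
  rewrite /oball /= subr0 rnormZ normrM normfV !gtr0_norm ?divr_gt0//.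
  by rewrite divfK ?gt_eqF//; lra.
rewrite /oball /= linear_fun0// subr0 linear_funZ// rnormZ.
rewrite normrM normfV !gtr0_norm ?divr_gt0// mulrAC ltr_pdivrMr// mul1r => H.
have : rnorm (A v) * d <= 2 * rnorm v by lra.
by rewrite -ler_pdivlMr// mulrAC.
Qed.

Lemma bounded_continuous_linear X Y (A : X -> Y) (C : R) : linear A ->
  norm_bound A C -> continuous_linear A.
Proof.
move=> linA bA; split=> // x U /nbhs_oballP[d d0 dU]; apply/nbhs_oballP.
(* [C] is an arbitrary real number here, so the denominator is made positive by taking |C| + 1. *)
exists (d / (`|C| + 1)); first by rewrite divr_gt0// ltr_wpDl.
move=> y; rewrite /oball /= => xy; apply: dU; rewrite /oball /= -linear_funB//.
apply: le_lt_trans (bA _) _; rewrite ltr_pdivlMr ?ltr_wpDl// in xy.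
apply: le_lt_trans xy; rewrite mulrC ler_wpM2l ?rnorm_ge0//.
by rewrite (le_trans (ler_norm C))// lerDl.
Qed.

Lemma continuous_linear_id X : continuous_linear (idfun : X -> X).
Proof.
by apply: (@bounded_continuous_linear _ _ _ 1) => // v; rewrite mul1r.
Qed.

Lemma continuous_linear_comp X Y Z (A : X -> Y) (B : Y -> Z) :
  continuous_linear A -> continuous_linear B -> continuous_linear (B \o A).
Proof.
move=> [linA cA] [linB cB]; split; first by move=> a u v /=; rewrite linA linB.
by move=> x; apply: continuous_comp; [exact: cA|exact: cB].
Qed.

Lemma continuous_linear_sub X Y (A B : X -> Y) :
  continuous_linear A -> continuous_linear B ->
  continuous_linear (fun v => A v - B v).
Proof.
move=> [linA cA] [linB cB]; split.
  by move=> a u v /=; rewrite linA linB scalerBr opprD addrACA.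
by move=> x; apply: cvgB; [exact: cA|exact: cB].
Qed.

Lemma opnorm_has_sup X Y (A : X -> Y) (C : R) : 0 <= C -> norm_bound A C ->
  has_sup [set rnorm (A v) | v in [set v : X | rnorm v <= 1]].
Proof.
move=> C0 bA; split; first by exists (rnorm (A 0)), 0 => //=; rewrite rnorm0.
exists C => _ [v /= v1 <-]; apply: le_trans (bA _) _.
by rewrite ler_piMr.
Qed.

(** Holds for any function: [sup] is 0 by default on a set without supremum, and otherwise dominates
    the norm of [A 0]. *)
Lemma opnorm_ge0 X Y (A : X -> Y) : 0 <= opnorm A.
Proof.
rewrite /opnorm; set S := (X in sup X).
have [S0|/sup_out->//] := pselect (has_sup S).
apply: (@le_trans _ _ (rnorm (A 0))); first exact: rnorm_ge0.
by apply: sup_upper_bound => //; exists 0 => //=; rewrite rnorm0.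
Qed.

Lemma opnorm_bound X Y (A : X -> Y) : continuous_linear A ->
  norm_bound A (opnorm A).
Proof.
move=> cA; have [C C0 bA] := continuous_linear_norm_bound cA.
have [linA _] := cA => v; have [->|/eqP/rnorm_gt0 v0] := eqVneq v 0.
  by rewrite linear_fun0// !rnorm0 mulr0.
rewrite -ler_pdivrMr//; apply: sup_upper_bound; first exact: opnorm_has_sup bA.
have E : `|(rnorm v)^-1| = (rnorm v)^-1 by rewrite gtr0_norm// invr_gt0.
exists (scal_real sk (rnorm v)^-1 *: v).
  by rewrite /= rnormZ E mulVf ?gt_eqF.
by rewrite linear_funZ// rnormZ E mulrC.
Qed.

End BoundedOperators.

(** * Orthogonal projection onto the closure of a real subspace *)

Section Projection.
Context (R : realType) (sk : scalar_kind) (X : hilbertSpace R sk).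

Lemma closure_oballP (M : set X) (x : X) :
  closure M x <-> forall d : R, 0 < d -> exists2 m, M m & rnorm (m - x) < d.
Proof.
split=> [Mx d d0|Mx U /nbhs_oballP[d d0 dU]].
  have /Mx[m [Mm xm]] : nbhs x (oball x d) by apply/nbhs_oballP; exists d.
  by exists m.
by have [m Mm mx] := Mx _ d0; exists m; split => //; exact: dU.
Qed.

(** Only real combinations are required: over the complex scalars the kernel of x |-> Re <A x, y> is
    in general not a complex subspace. *)
Definition real_subspace (M : set X) :=
  M 0 /\ forall a u v, M u -> M v -> M (scal_real sk a *: u + v).

(** A minimizing sequence for the distance from [w] to [M] is Cauchy by the parallelogram law. Its
    limit [m] realizes the distance, and minimality along each direction [v] gives orthogonality. As
    [M] need not be closed, [m] lies in the closure only. *)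
Lemma projection (M : set X) (w : X) : real_subspace M ->
  exists2 m, closure M m & forall v, M v -> rdot (w - m) v = 0.
Proof.
move=> [M0 MD]; pose D := [set rnorm (w - m) | m in M].
have Dinf : has_inf D.
  split; first by exists (rnorm (w - 0)), 0.
  by exists 0 => _ [m _ <-]; exact: rnorm_ge0.
have dle m : M m -> inf D <= rnorm (w - m).
  by move=> Mm; apply: ge_inf; [exact: Dinf.2|exists m].
have d_ge0 : 0 <= inf D.
  by apply: lb_le_inf; [exact: Dinf.1|move=> _ [m _ <-]; exact: rnorm_ge0].
have /choice[u uP] : forall n : nat, exists m, M m /\ rnorm (w - m) < inf D + n.+1%:R^-1.
  move=> n; have n0 : 0 < n.+1%:R^-1 :> R by rewrite invr_gt0.
  by have [_ [m Mm <-] ?] := inf_adherent n0 Dinf; exists m.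
have small (e : R) : 0 < e -> exists N : nat, forall n, (N <= n)%N -> n.+1%:R^-1 < e :> R.
  move=> e0; exists (Num.truncn e^-1) => n Nn.
  rewrite invf_plt ?posrE// (lt_le_trans (truncnS_gt _))// ler_nat.
  by rewrite ltnS.
have [m um] : exists m : X, u @ \oo --> m.
  apply: cauchy_rnorm_cvg => e e0.
  (* When both distances are at most inf D + eps, the parallelogram law gives |u_i - u_j|^2 <= 4
     (inf D + eps)^2 - 4 (inf D)^2 <= eps (8 inf D + 4) for eps <= 1; 5 in place of 4 makes the
     final inequality strict. *)
  have K0 : 0 < 8 * inf D + 5 by lra.
  have [eps [eps0 eps1 epsK]] : exists eps : R, [/\ 0 < eps, eps <= 1 &
      eps * (8 * inf D + 5) <= e ^+ 2].
    exists (Num.min 1 (e ^+ 2 / (8 * inf D + 5))); split.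
    - by rewrite lt_min ltr01 divr_gt0// exprn_gt0.
    - by rewrite ge_min lexx.
    - by rewrite -ler_pdivlMr// ge_min lexx orbT.
  have [N Nle] := small _ eps0; exists N => i j Ni Nj.
  have [Mi wi] := uP i; have [Mj wj] := uP j.
  have {}wi : rnorm (w - u i) <= inf D + eps.
    by rewrite (le_trans (ltW wi))// lerD2l ltW// Nle.
  have {}wj : rnorm (w - u j) <= inf D + eps.
    by rewrite (le_trans (ltW wj))// lerD2l ltW// Nle.
  (* The midpoint belongs to [M], so its distance to [w] is at least inf D; this bounds the sum term
     of the parallelogram law from below. *)
  have half : M (scal_real sk 2^-1 *: (u i + u j)).
    rewrite -[X in M X]addr0; apply: (MD) => //.
    by rewrite -[X in X + _](scale1r (u i)) -(scal_real1 R sk); exact: (MD).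
  have := dle _ half.
  have -> : rnorm (w - scal_real sk 2^-1 *: (u i + u j)) =
            2^-1 * rnorm ((w - u j) + (w - u i)).
    rewrite -[X in X * _]ger0_norm// -rnormZ; congr rnorm.
    rewrite addrACA -opprD (addrC (u j)) scalerBr; congr (_ - _).
    rewrite -{2 3}[w]scale1r -scalerDl -(scal_real1 R sk) -scal_realD scalerA -scal_realM.
    rewrite (_ : 2^-1 * (1 + 1) = 1) ?scal_real1 ?scale1r//; lra.
  have := rnorm_parallelogram (w - u j) (w - u i).
  have -> : w - u j - (w - u i) = u i - u j by rewrite opprB addrC subrKA.
  move: (rnorm_ge0 (w - u i)) (rnorm_ge0 (w - u j)) (rnorm_ge0 (u i - u j)) wi wj.
  move: (rnorm (u i - u j)) (rnorm (w - u i)) (rnorm (w - u j)) (rnorm (w - u j + _)).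
  move=> a b c f b0 c0 a0 bd cd par df.
  have f2 : (2 * inf D) ^+ 2 <= f ^+ 2.
    by rewrite lerXn2r ?nnegrE//; lra.
  have b2 : b ^+ 2 <= (inf D + eps) ^+ 2 by rewrite lerXn2r ?nnegrE//; lra.
  have c2 : c ^+ 2 <= (inf D + eps) ^+ 2 by rewrite lerXn2r ?nnegrE//; lra.
  have a2 : a ^+ 2 < e ^+ 2 by nra.
  by rewrite ltNge; apply/negP => ea; move: a2; rewrite ltNge lerXn2r ?nnegrE// ltW.
have Mm : closure M m.
  apply/closure_oballP => e e0.
  have [N _ /(_ N (leqnn N)) /= ?] := (cvg_rnormP u m _).1 um e e0.
  by exists (u N) => //; exact: (uP N).1.
have wm : rnorm (w - m) <= inf D.
  apply/ler_addgt0Pr => e e0.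
  have : (fun n => w - u n) @ \oo --> w - m by apply: cvgB => //; exact: cvg_cst.
  move/cvg_rnorm/cvgr_to_le; apply.
  have [N NP] := small _ e0; exists N => // n /= Nn.
  by rewrite (le_trans (ltW (uP n).2))// lerD2l ltW// NP.
exists m => // v Mv.
(* [m] may lie outside [M], so it is replaced by a nearby m' in [M], at an arbitrarily small
   cost. *)
have key a : inf D <= rnorm (w - m - scal_real sk a *: v).
  apply/ler_addgt0Pr => e e0.
  have [m' Mm' m'm] := (closure_oballP M m).1 Mm _ e0.
  have := dle _ (MD a _ _ Mv Mm').
  have := ler_rnormD (w - m - scal_real sk a *: v) (m - m').
  have -> : w - m - scal_real sk a *: v + (m - m') = w - (scal_real sk a *: v + m').
    rewrite addrCA addrAC addrA (addrC w) !addrA.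
    by rewrite addrAC addrN add0r opprD addrA addrAC.
  by rewrite (rnormC m m'); lra.
have [->|/eqP/rnorm_gt0 v0] := eqVneq v 0.
  by rewrite -(scale0r (0 : X)) -(scal_real0 R sk) rdotZr mul0r.
(* This [a] minimizes |w - m - a v|; the minimum of the square is |w - m|^2 - (Re <w - m, v> /
   |v|)^2, which forces the product to vanish. *)
pose a := rdot (w - m) v / rnorm v ^+ 2.
have := key a; have := rnorm_ge0 (w - m) => wm0 ka.
have : rnorm (w - m) ^+ 2 <= rnorm (w - m - scal_real sk a *: v) ^+ 2.
  by rewrite lerXn2r ?nnegrE ?rnorm_ge0// (le_trans wm).
rewrite /a; move: (w - m) => q.
rewrite -[X in _ <= X]rdotxx rdotBl !rdotBr !rdotZl !rdotZr !rdotxx (rdotC v).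
move: (rdot q v) (rnorm v) v0 (rnorm q) => r n n0 x.
have -> : x ^+ 2 - r / n ^+ 2 * r -
    (r / n ^+ 2 * r - r / n ^+ 2 * (r / n ^+ 2 * n ^+ 2)) = x ^+ 2 - (r / n) ^+ 2.
  by field; rewrite gt_eqF.
rewrite lerBrDr gerDl => rn.
have : (r / n) ^+ 2 == 0 by rewrite eq_le rn sqr_ge0.
by rewrite sqrf_eq0 mulf_eq0 invr_eq0 (gt_eqF n0) orbF => /eqP.
Qed.

End Projection.

(** * Riesz representation, adjoints, and the bounded inverse theorem *)

Section Adjoint.
Context (R : realType) (sk : scalar_kind).
Implicit Types (X Y : hilbertSpace R sk).

(** Riesz argument: the kernel [M] of x |-> Re <A x, y> is closed, and a vector [u] orthogonal to it
    represents the functional after scaling, because each x differs from a real multiple of [u] by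
    an element of [M]. *)
Lemma rdot_representation X Y (A : X -> Y) (y : Y) : continuous_linear A ->
  exists z, forall x, rdot (A x) y = rdot x z.
Proof.
move=> cA; have [linA _] := cA; have [C C0 bA] := continuous_linear_norm_bound cA.
have linf a u v : rdot (A (scal_real sk a *: u + v)) y =
    a * rdot (A u) y + rdot (A v) y.
  by rewrite linA rdotDl rdotZl.
pose M : set X := [set x | rdot (A x) y = 0].
have Msub : real_subspace M.
  split=> [|a u v]; rewrite /M /=; last by rewrite linf => -> ->; rewrite mulr0 addr0.
  by rewrite linear_fun0// -(scale0r (0 : Y)) -(scal_real0 R sk) rdotZl mul0r.
have Mclosed x : closure M x -> M x.
  move=> Mx; apply/eqP; rewrite -normr_le0; apply/ler_addgt0Pr => e e0.
  rewrite add0r; pose L := C * rnorm y + 1.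
  (* The summand 1 in [L] allows division by [L] even when C |y| is zero. *)
  have L0 : 0 < L by rewrite ltr_wpDl// mulr_ge0// rnorm_ge0.
  have [m Mm mx] := (closure_oballP M x).1 Mx (e / L) (divr_gt0 e0 L0).
  have Bnd v : rdot (A v) y <= L * rnorm v.
    apply: le_trans (rdot_CauchySchwarz _ _) _; rewrite /L mulrDl mul1r.
    rewrite mulrAC ler_wpDr ?rnorm_ge0// ler_wpM2r ?rnorm_ge0//.
  have := Bnd (m - x); have := Bnd (x - m); rewrite (rnormC x).
  rewrite !linear_funB// !rdotBl [rdot (A m) y]Mm.
  move: mx; rewrite ltr_pdivlMr// mulrC => mx H1 H2.
  by rewrite ler_norml; apply/andP; split; lra.
have [allM|/existsNP[x0 Mx0]] := pselect (forall x, M x).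
  exists 0 => x; rewrite [LHS]allM.
  by rewrite -(scale0r (0 : X)) -(scal_real0 R sk) rdotZr mul0r.
have [m /Mclosed Mm orth] := projection x0 Msub.
set u := x0 - m in orth.
have fu : rdot (A u) y = rdot (A x0) y.
  by rewrite /u linear_funB// rdotBl [rdot (A m) y]Mm subr0.
have fu0 : rdot (A u) y != 0 by rewrite fu; apply/eqP.
have u0 : 0 < rnorm u.
  apply: rnorm_gt0 => u0; move: fu0; rewrite u0 linear_fun0//.
  by rewrite -(scale0r (0 : Y)) -(scal_real0 R sk) rdotZl mul0r eqxx.
exists (scal_real sk (rdot (A u) y / rnorm u ^+ 2) *: u) => x.
have : M (scal_real sk (- (rdot (A x) y / rdot (A u) y)) *: u + x).
  by rewrite /M /= linf mulNr divfK// addNr.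
move/orth; rewrite rdotDr !rdotZr rdotxx (rdotC u) => /eqP.
rewrite mulNr addrC subr_eq0 => /eqP ->.
by field; rewrite fu0 gt_eqF.
Qed.

(** The real representation upgraded by [rdot_hdot] shows that a representing vector exists, so
    [xget] does not return its default 0. *)
Lemma hdot_adjoint X Y (A : X -> Y) : continuous_linear A ->
  forall x y, hdot Y (A x) y = hdot X x (adjoint A y).
Proof.
move=> cA x y; have [z zP] := rdot_representation y cA.
have := @xgetPex _ 0 [set z : X | forall x : X, hdot Y (A x) y = hdot X x z].
by apply; exists z; apply: rdot_hdot => //; exact: cA.1.
Qed.

Lemma rdot_adjoint X Y (A : X -> Y) : continuous_linear A ->
  forall x y, rdot (A x) y = rdot x (adjoint A y).
Proof. by move=> cA x y; rewrite /rdot hdot_adjoint. Qed.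

Lemma rdot_eq0 X (z : X) : (forall x, rdot x z = 0) -> z = 0.
Proof.
by move=> /(_ z); rewrite rdotxx => /eqP; rewrite sqrf_eq0 => /eqP/rnorm_eq0.
Qed.

(** Boundedness comes from |z|^2 = Re <A z, y> <= C |z| |y| with z = [adjoint A y]. *)
Lemma adjoint_continuous_linear X Y (A : X -> Y) : continuous_linear A ->
  continuous_linear (adjoint A).
Proof.
move=> cA; have [C C0 bA] := continuous_linear_norm_bound cA.
apply: (@bounded_continuous_linear _ _ _ _ _ C).
  move=> a y1 y2; apply/eqP; rewrite -subr_eq0; apply/eqP/rdot_eq0 => x.
  rewrite rdotBr; apply/eqP; rewrite subr_eq0; apply/eqP; rewrite /rdot.
  by rewrite -hdot_adjoint// !linearDr !linearZr_LR /= !hdot_adjoint.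
move=> y; have [->|/eqP/rnorm_gt0 z0] := eqVneq (adjoint A y) 0.
  by rewrite rnorm0 mulr_ge0// rnorm_ge0.
rewrite -(ler_pM2l z0) -expr2 -rdotxx -rdot_adjoint//.
rewrite (le_trans (rdot_CauchySchwarz _ _))// mulrA (mulrC _ C).
by rewrite ler_wpM2r ?rnorm_ge0.
Qed.

Lemma range_real_subspace X Y (A : X -> Y) : linear A ->
  real_subspace (range A).
Proof.
move=> linA; split; first by exists 0 => //; rewrite linear_fun0.
by move=> a _ _ [u _ <-] [v _ <-]; exists (scal_real sk a *: u + v); rewrite // linA.
Qed.

Lemma projection_range X Y (A : X -> Y) (y : Y) : continuous_linear A ->
  exists2 m, closure (range A) m & adjoint A (y - m) = 0.
Proof.
move=> cA; have [m mA orth] := projection y (range_real_subspace cA.1).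
exists m => //; apply: rdot_eq0 => x; rewrite -rdot_adjoint// rdotC.
by apply: orth; exists x.
Qed.

(** The part of [v] orthogonal to the range of the adjoint is killed by [A], hence is 0 by
    injectivity. *)
Lemma adjoint_range_dense X Y (A : X -> Y) : continuous_linear A ->
  injective A -> forall v, closure (range (adjoint A)) v.
Proof.
move=> cA injA v; have cB := adjoint_continuous_linear cA.
have [m mA orth] := projection v (range_real_subspace cB.1).
suff -> : v = m by [].
apply: injA; apply/eqP; rewrite -subr_eq0 -linear_funB; last exact: cA.1.
apply/eqP/rdot_eq0 => y; rewrite rdotC rdot_adjoint//.
by apply: orth; exists y.
Qed.

Lemma expr3V_small (e : R) : 0 < e -> exists N : nat, 3^-1 ^+ N < e.
Proof.
move=> e0; have : (fun n => 3^-1 ^+ n : R) @ \oo --> 0.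
  by apply: cvg_expr; rewrite ger0_norm// invf_lt1// ltr1n.
move/cvgrPdist_lt => /(_ e e0)[N _ /(_ N (leqnn N)) /=].
by rewrite sub0r normrN ger0_norm ?exprn_ge0// => ?; exists N.
Qed.

(* Gliding hump: if the y_n are too large, then the series of the vectors
   +- 3^-n y_n / |y_n|, with signs chosen along the way, converges to some A v
   whose products with the y_n are unbounded, although each is at most |v|. *)
Lemma adjoint_unit_ball_bounded X Y (A : X -> Y) : continuous_linear A ->
  closed (range A) ->
  exists M : R, forall y, range A y -> rnorm (adjoint A y) <= 1 -> rnorm y <= M.
Proof.
move=> cA clA; apply: contrapT => /forallNP noM.
(* The size is chosen so that half of 3^-n |y_n| exceeds n + 1. *)
have /choice[y yP] : forall n : nat, exists y, [/\ range A y,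
    rnorm (adjoint A y) <= 1 & 2 * n.+1%:R * 3 ^+ n < rnorm y].
  move=> n; have /existsNP[y] := noM (2 * n.+1%:R * 3 ^+ n).
  move=> /not_implyP[Ay /not_implyP[y1 /negP]]; rewrite -ltNge => yn.
  by exists y.
have y0 n : 0 < rnorm (y n).
  by have [_ _] := yP n; apply: le_lt_trans; rewrite !mulr_ge0// exprn_ge0.
pose c n : R := 3^-1 ^+ n.
have c0 n : 0 < c n by rewrite exprn_gt0.
have cS n : c n.+1 = c n / 3 by rewrite /c exprSr.
(* The sign prevents the new term from cancelling the product of the partial sum with [y n]; after
   it is added, that product is at least 3^-n |y_n| in absolute value. *)
pose sg (w : Y) n : R := if 0 <= rdot w (y n) then c n / rnorm (y n)
                         else - (c n / rnorm (y n)).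
pose fix w (n : nat) : Y :=
  if n is m.+1 then scal_real sk (sg (w m) m) *: y m + w m else 0.
have wA n : range A (w n).
  elim: n => [|n wn] /=; first by exists 0 => //; rewrite linear_fun0//; exact: cA.1.
  by apply: (range_real_subspace cA.1).2 => //; have [] := yP n.
have wS n : rnorm (w n.+1 - w n) = c n.
  rewrite /= addrK rnormZ /sg; case: ifP => _; rewrite ?normrN;
  by rewrite gtr0_norm ?divr_gt0// divfK// gt_eqF.
have wy n : c n * rnorm (y n) <= `|rdot (w n.+1) (y n)|.
  rewrite /= rdotDl rdotZl rdotxx /sg.
  have E : c n / rnorm (y n) * rnorm (y n) ^+ 2 = c n * rnorm (y n).
    by rewrite expr2 mulrA divfK// gt_eqF.
  have E0 : 0 <= c n * rnorm (y n) by rewrite mulr_ge0// ltW.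
  case: ifPn => [wy0|]; first by rewrite E ger0_norm ?addr_ge0// lerDl.
  rewrite -ltNge mulNr E => wy0; rewrite ltr0_norm ?opprD ?opprK; last lra.
  by rewrite lerDl; lra.
(* Geometric sum of ratio 1/3. Started at n + 1, the whole tail is at most c_n / 2, so it destroys
   at most half of the hump at [n]. *)
have wC n k : rnorm (w (n + k)%N - w n) <= 3 / 2 * (c n - c (n + k)%N).
  elim: k => [|k IH]; first by rewrite addn0 !subrr rnorm0 mulr0.
  have := ler_rnormD (w (n + k.+1)%N - w (n + k)%N) (w (n + k)%N - w n).
  rewrite subrKA addnS wS cS; lra.
have wC' n m : (n <= m)%N -> rnorm (w m - w n) <= 3 / 2 * c n.
  by move=> /subnKC <-; apply: le_trans (wC _ _) _; have := c0 (n + (m - n))%N; lra.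
have [l wl] : exists l : Y, w @ \oo --> l.
  apply: cauchy_rnorm_cvg => e e0.
  have [N Ne] := expr3V_small (divr_gt0 e0 (ltr0Sn R 2)).
  exists N => i j Ni Nj; have := wC' _ _ Ni; have := wC' _ _ Nj.
  have := ler_rnormD (w i - w N) (w N - w j).
  rewrite subrKA (rnormC (w N)) -/(c N) in Ne *; lra.
have [v _ vl] : range A l.
  apply: clA; apply/closure_oballP => e e0.
  have [N _ /(_ N (leqnn N)) /= ?] := (cvg_rnormP w l _).1 wl e e0.
  by exists (w N) => //; exact: wA.
have [n nv] : exists n : nat, rnorm v < n.+1%:R.
  by exists (Num.truncn (rnorm v)); exact: truncnS_gt.
have [_ yn1 yn] := yP n.
have lw : rnorm (l - w n.+1) <= c n / 2.
  have : (fun k => w (k + n.+1)%N) @ \oo --> l by rewrite cvg_shiftn.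
  apply: rnorm_le_cvg => k; apply: le_trans (wC' _ _ (leq_addl _ _)) _.
  by rewrite cS; lra.
have vy : `|rdot l (y n)| <= rnorm v.
  rewrite -vl rdot_adjoint// ler_norml; apply/andP; split; last first.
    apply: le_trans (rdot_CauchySchwarz _ _) _.
    by rewrite ler_piMr// rnorm_ge0.
  rewrite lerNl -rdotNl; apply: le_trans (rdot_CauchySchwarz _ _) _.
  by rewrite rnormN ler_piMr// rnorm_ge0.
have lwy : `|rdot (w n.+1 - l) (y n)| <= c n / 2 * rnorm (y n).
  rewrite ler_norml; apply/andP; split; last first.
    apply: le_trans (rdot_CauchySchwarz _ _) _.
    by rewrite rnormC ler_wpM2r// rnorm_ge0.
  rewrite lerNl -rdotNl opprB; apply: le_trans (rdot_CauchySchwarz _ _) _.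
  by rewrite ler_wpM2r// rnorm_ge0.
have big : n.+1%:R < c n / 2 * rnorm (y n).
  rewrite -ltr_pdivrMl ?divr_gt0// /c invfM invrK exprVn invrK.
  by rewrite -mulrA mulrC.
(* With l = A v, c_n |y_n| <= c_n |y_n| / 2 + |v|, whereas |v| < n + 1 < c_n |y_n| / 2. *)
have := ler_normD (rdot (w n.+1 - l) (y n)) (rdot l (y n)).
have := wy n; rewrite rdotBl subrK in lwy *; lra.
Qed.

(** The adjoint is bounded below on the range of [A], with constant [M], and the image of that range
    is dense. Approximating [v] by z = [adjoint A y] with [y] in the range, |v|^2 is close to Re <v,
    z> = Re <A v, y> <= M |A v| |z|. *)
Lemma injective_closed_range_bounded_below X Y (A : X -> Y) :
  continuous_linear A -> injective A -> closed (range A) ->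
  exists2 C : R, 0 <= C & forall v, rnorm v <= C * rnorm (A v).
Proof.
move=> cA injA clA; have [linA _] := cA; have [M bM] := adjoint_unit_ball_bounded cA clA.
have cB := adjoint_continuous_linear cA; have [linB _] := cB.
have M0 : 0 <= M.
  apply: le_trans (rnorm_ge0 (0 : Y)) _.
  apply: bM; first by exists 0 => //; rewrite linear_fun0.
  by rewrite linear_fun0// rnorm0.
have adjM y : range A y -> rnorm y <= M * rnorm (adjoint A y).
  move=> [x _ xy]; have [By0|/eqP/rnorm_gt0 By0] := eqVneq (adjoint A y) 0.
    have : rnorm y ^+ 2 == 0.
      by rewrite -rdotxx -{1}xy rdot_adjoint// By0 -(scale0r (0 : X))
        -(scal_real0 R sk) rdotZr mul0r.
    by rewrite sqrf_eq0 => /eqP ->; rewrite mulr_ge0// rnorm_ge0.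
  have inv0 : `|(rnorm (adjoint A y))^-1| = (rnorm (adjoint A y))^-1.
    by rewrite gtr0_norm// invr_gt0.
  rewrite -ler_pdivrMr// mulrC -inv0 -rnormZ; apply: bM.
    exists (scal_real sk (rnorm (adjoint A y))^-1 *: x) => //.
    by rewrite linear_funZ// xy.
  by rewrite linear_funZ// rnormZ inv0 mulVf// gt_eqF.
exists M => // v; have [->|/eqP/rnorm_gt0 v0] := eqVneq v 0.
  by rewrite rnorm0 mulr_ge0// rnorm_ge0.
rewrite -(ler_pM2r v0) -expr2; apply/ler_addgt0Pr => e e0.
(* This is the total factor of |z - v| in the estimate of |v|^2, so an approximation within e / L
   costs at most [e]. *)
have L0 : 0 < M * rnorm (A v) + rnorm v by rewrite ltr_wpDl// mulr_ge0// rnorm_ge0.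
have dense : closure (range (adjoint A)) v by exact: adjoint_range_dense.
have [_ [y0 _ <-]] := (closure_oballP _ v).1 dense _ (divr_gt0 e0 L0).
(* Projecting [y0] onto the closed range does not change its image under the adjoint. *)
have [y yA] := projection_range y0 cA.
have {yA} yA : range A y by exact: clA.
rewrite linear_funB// => /eqP; rewrite subr_eq0 => /eqP ->.
rewrite ltr_pdivlMr//; set z := adjoint A y => zv.
have := rdot_CauchySchwarz v (v - z); rewrite rdotBr rdotxx (rnormC v) => H1.
have : rdot v z <= rnorm (A v) * (M * rnorm z).
  rewrite /z -rdot_adjoint// (le_trans (rdot_CauchySchwarz _ _))//.
  by rewrite ler_wpM2l ?rnorm_ge0// adjM.
have zz : rnorm z <= rnorm (z - v) + rnorm v.
  by rewrite -{1}(subrK v z) ler_rnormD.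
have AM : 0 <= M * rnorm (A v) by rewrite mulr_ge0// rnorm_ge0.
have := ler_wpM2l AM zz; lra.
Qed.

End Adjoint.

(** * Operators bounded below, their normal operators and Moore-Penrose inverses *)

Section Coercive.
Context (R : realType) (sk : scalar_kind).
Implicit Types (X Y : hilbertSpace R sk).

Lemma invertible_invop X Y (A : X -> Y) : invertible_op A ->
  [/\ continuous_linear (invop A), cancel A (invop A) & cancel (invop A) A].
Proof.
move=> [_ [G [cG AG GA]]].
have Ainv : cancel A (invop A).
  by move=> x; apply: pinvKV; rewrite ?inE// => ? ? _ _ /(can_inj AG).
suff -> : invop A = G by [].
by apply/funext => y; rewrite -{1}(GA y) Ainv.
Qed.

(** Preimages of a convergent sequence of values form a Cauchy sequence, and [X] is complete. *)
Lemma bounded_below_closed_range X Y (A : X -> Y) (C : R) :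
  continuous_linear A -> 0 <= C -> (forall v, rnorm v <= C * rnorm (A v)) ->
  forall z, closure (range A) z -> exists u, A u = z.
Proof.
move=> cA C0 bA z zA; have [linA _] := cA.
have [D D0 bD] := continuous_linear_norm_bound cA.
have /choice[u uP] : forall n : nat, exists u, rnorm (A u - z) < 3^-1 ^+ n.
  move=> n; have e0 : 0 < 3^-1 ^+ n :> R by rewrite exprn_gt0.
  by have [_ [u _ <-] ?] := (closure_oballP _ z).1 zA _ e0; exists u.
have uN (N m : nat) : (N <= m)%N -> rnorm (A (u m) - z) < 3^-1 ^+ N.
  move=> Nm; apply: lt_le_trans (uP m) _.
  by rewrite ler_wiXn2l// invf_le1// ler1n.
have [l ul] : exists l : X, u @ \oo --> l.
  apply: cauchy_rnorm_cvg => e e0.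
  have L0 : 0 < 2 * C + 1 by lra.
  have [N Ne] := expr3V_small (divr_gt0 e0 L0); exists N => m n Nm Nn.
  have := bA (u m - u n); rewrite linear_funB//.
  have := ler_rnormB (A (u m) - z) (A (u n) - z); rewrite opprB subrKA => H1 H2.
  have := uN _ _ Nm; have := uN _ _ Nn.
  rewrite ltr_pdivlMr// in Ne; have := ler_wpM2l C0 H1; nra.
exists l; apply/eqP; rewrite -subr_eq0; apply/eqP/rnorm_eq0.
apply/eqP; rewrite eq_le rnorm_ge0 andbT; apply/ler_addgt0Pr => e e0.
have e2 : 0 < e / 2 by lra.
have [N Ne] := expr3V_small e2.
have [M _ Me] := (cvg_rnormP u l _).1 ul _ (divr_gt0 e2 (ltr_wpDl D0 ltr01)).
have {Me} := Me (maxn N M) (leq_maxr _ _); rewrite /= ltr_pdivlMr ?ltr_wpDl//.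
have := uN N (maxn N M) (leq_maxl _ _); move: (u _) => v H1 H2.
have := ler_rnormB (A v - z) (A (v - l)).
have -> : A v - z - A (v - l) = A l - z.
  by rewrite linear_funB// opprB addrC subrKA.
have := bD (v - l); have := rnorm_ge0 (v - l); lra.
Qed.

Lemma normal_op_continuous_linear X Y (A : X -> Y) : continuous_linear A ->
  continuous_linear (normal_op A).
Proof.
by move=> cA; apply: continuous_linear_comp => //; exact: adjoint_continuous_linear.
Qed.

Lemma rdot_normal_op X Y (A : X -> Y) : continuous_linear A ->
  forall u v, rdot u (normal_op A v) = rdot (A u) (A v).
Proof. by move=> cA u v; rewrite /normal_op /= -rdot_adjoint. Qed.

(** |v|^2 <= C^2 |A v|^2 = C^2 Re <v, N v> for N = [normal_op A]; Cauchy-Schwarz then cancels one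
    |v|. *)
Lemma bounded_below_normal_op X Y (A : X -> Y) (C : R) :
  continuous_linear A -> 0 <= C -> (forall v, rnorm v <= C * rnorm (A v)) ->
  forall v, rnorm v <= C ^+ 2 * rnorm (normal_op A v).
Proof.
move=> cA C0 bA v; have [->|/eqP/rnorm_gt0 v0] := eqVneq v 0.
  by rewrite rnorm0 mulr_ge0// ?sqr_ge0// rnorm_ge0.
rewrite -(ler_pM2l v0) -expr2.
apply: (@le_trans _ _ (C ^+ 2 * rnorm (A v) ^+ 2)).
  by rewrite -exprMn lerXn2r ?nnegrE ?mulr_ge0 ?rnorm_ge0.
rewrite -rdotxx -rdot_normal_op// mulrCA ler_wpM2l ?sqr_ge0//.
exact: rdot_CauchySchwarz.
Qed.

(** The range of N = [normal_op A] is closed. It is also dense: if q is orthogonal to it, then |A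
    q|^2 = Re <q, N q> = 0. The lower bound on N gives injectivity and the continuity of the
    inverse. *)
Lemma bounded_below_normal_op_invertible X Y (A : X -> Y) (C : R) :
  continuous_linear A -> 0 <= C -> (forall v, rnorm v <= C * rnorm (A v)) ->
  invertible_op (normal_op A).
Proof.
move=> cA C0 bA; have cN := normal_op_continuous_linear cA; split=> //.
have bN := bounded_below_normal_op cA C0 bA; have [linN _] := cN.
have surj z : exists u, normal_op A u = z.
  apply: (bounded_below_closed_range cN (sqr_ge0 C) bN).
  have [m mN orth] := projection z (range_real_subspace linN).
  suff -> : z = m by [].
  have : rnorm (A (z - m)) ^+ 2 == 0.
    by rewrite -rdotxx -rdot_normal_op//; apply/eqP/orth; exists (z - m).
  rewrite sqrf_eq0 => /eqP Azm; apply/eqP; rewrite -subr_eq0.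
  apply/eqP/rnorm_eq0/eqP; rewrite eq_le rnorm_ge0 andbT.
  by rewrite (le_trans (bA _))// Azm mulr0.
have /choice[G GP] := surj.
have injN u v : normal_op A u = normal_op A v -> u = v.
  move=> uv; apply/eqP; rewrite -subr_eq0; apply/eqP/rnorm_eq0/eqP.
  rewrite eq_le rnorm_ge0 andbT (le_trans (bN _))//.
  by rewrite linear_funB// uv subrr rnorm0 mulr0.
exists G; split=> //; last by move=> u; apply: injN; rewrite GP.
apply: (@bounded_continuous_linear _ _ _ _ _ (C ^+ 2)).
  by move=> a u v; apply: injN; rewrite linN !GP.
by move=> z; rewrite -[in leRHS](GP z); exact: bN.
Qed.

Lemma mp_inverse_cancel X Y (A : X -> Y) : invertible_op (normal_op A) ->
  cancel A (mp_inverse A).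
Proof. by move=> iN v; have [_ + _] := invertible_invop iN; apply. Qed.

Lemma normal_op_mp_inverse X Y (A : X -> Y) : invertible_op (normal_op A) ->
  forall y, normal_op A (mp_inverse A y) = adjoint A y.
Proof. by move=> iN v; have [_ _ +] := invertible_invop iN; apply. Qed.

(** For u = A^+ y, |A u|^2 = Re <u, N u> = Re <A u, y>, so |A u| <= |y|. *)
Lemma mp_inverse_norm_bound X Y (A : X -> Y) (C : R) :
  continuous_linear A -> 0 <= C -> (forall v, rnorm v <= C * rnorm (A v)) ->
  norm_bound (mp_inverse A) C.
Proof.
move=> cA C0 bA y; have iN := bounded_below_normal_op_invertible cA C0 bA.
set u := mp_inverse A y; apply: le_trans (bA u) _; rewrite ler_wpM2l//.
have [->|/eqP/rnorm_gt0 Au0] := eqVneq (A u) 0; first by rewrite rnorm0 rnorm_ge0.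
rewrite -(ler_pM2l Au0) -expr2 -rdotxx -rdot_normal_op//.
by rewrite normal_op_mp_inverse// -rdot_adjoint// rdot_CauchySchwarz.
Qed.

Lemma mp_inverse_continuous_linear X Y (A : X -> Y) : continuous_linear A ->
  invertible_op (normal_op A) -> continuous_linear (mp_inverse A).
Proof.
move=> cA iN; have [cI _ _] := invertible_invop iN.
by apply: continuous_linear_comp => //; exact: adjoint_continuous_linear.
Qed.

(** Some lower bound [C] shows that A^+ is continuous, hence controlled by its operator norm; the
    constant stated then comes from v = A^+ A v. *)
Lemma rnorm_le_opnorm_mp_inverse X Y (A : X -> Y) :
  continuous_linear A -> injective A -> closed (range A) ->
  forall v, rnorm v <= opnorm (mp_inverse A) * rnorm (A v).
Proof.
move=> cA injA clA v.
have [C C0 bA] := injective_closed_range_bounded_below cA injA clA.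
have iN := bounded_below_normal_op_invertible cA C0 bA.
rewrite -{1}(mp_inverse_cancel iN v).
exact/opnorm_bound/mp_inverse_continuous_linear.
Qed.

End Coercive.

(** * A mean value inequality along a segment *)

Section MeanValue.
Context (R : realType) (sk : scalar_kind) (X Y : hilbertSpace R sk).
Implicit Types (F : X -> Y).

Lemma differentiable_continuous_linear F (z : X) : differentiable F z ->
  continuous_linear ('d F z).
Proof.
move=> dF; split; last exact: diff_continuous.
by move=> a u v; rewrite linearP.
Qed.

Lemma differentiable_rnorm F (z : X) : differentiable F z ->
  forall e : R, 0 < e -> exists2 d : R, 0 < d & forall v, rnorm v < d ->
    rnorm (F (v + z) - F z - 'd F z v) <= e * rnorm v.
Proof.
move=> /diff_locally/eqaddoP dF e e0.
have /dF/nbhs_oballP[d d0 dP] : 0 < scal_real sk e.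
  by rewrite -(scal_real0 R sk) ltr_scal_real.
exists d => // v vd; have /dP : oball 0 d v by rewrite /oball /= subr0.
by rewrite /= !normE -scal_realM ler_scal_real opprD addrA.
Qed.

(** Pairing with a fixed [u] yields a real function of a real variable, whatever the scalar field,
    so the one-variable mean value theorem becomes available. *)
Lemma is_derive_rdot_line F (a e : X) (u : Y) (s : R) :
  differentiable F (a + scal_real sk s *: e) ->
  is_derive s 1 (fun s => rdot (F (a + scal_real sk s *: e)) u)
    (rdot ('d F (a + scal_real sk s *: e) e) u).
Proof.
set z := a + _ => dF; set f := fun s => rdot _ _.
have [linD _] := differentiable_continuous_linear dF.
suff lim : (fun h => h^-1 *: ((f \o shift s) (h *: (1 : R^o)) - f s)) @ 0^' -->
    rdot ('d F z e) u.
  by apply: DeriveDef; [exact: cvgP lim|exact: cvg_lim lim].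
apply/cvgrPdist_le => eps eps0.
pose L := rnorm e * rnorm u + 1.
have L0 : 0 < L by rewrite ltr_wpDl// mulr_ge0// rnorm_ge0.
have [d d0 dP] := differentiable_rnorm dF (divr_gt0 eps0 L0).
have e1 : 0 < rnorm e + 1 by rewrite ltr_wpDl// rnorm_ge0.
apply/nbhs_normP; exists (d / (rnorm e + 1)); first by rewrite /= divr_gt0.
move=> h; rewrite /= sub0r normrN ltr_pdivlMr// => hd h0.
have hgt0 : 0 < `|h| by rewrite normr_gt0.
have hz : a + scal_real sk (h + s) *: e = scal_real sk h *: e + z.
  by rewrite /z addrCA -scalerDl -scal_realD.
have hes : rnorm (scal_real sk h *: e) < d.
  by rewrite rnormZ; apply: le_lt_trans hd; rewrite ler_wpM2l// lerDl.
have {dP} := dP _ hes; set rem := F _ - _ - _ => remP.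
have -> : rdot ('d F z e) u - h^-1 *: (f (h *: (1 : R^o) + s) - f s) =
          - (h^-1 * rdot rem u).
  rewrite /f /= /rem -/z.
  have -> : h *: (1 : R^o) = h by rewrite /GRing.scale /= mulr1.
  rewrite hz linear_funZ// !rdotBl rdotZl /GRing.scale /=.
  by field.
rewrite normrN normrM normfV ler_pdivrMl//.
have rdot_le (v : Y) : `|rdot v u| <= rnorm v * rnorm u.
  rewrite ler_norml rdot_CauchySchwarz andbT lerNl -rdotNl -(rnormN v).
  exact: rdot_CauchySchwarz.
apply: le_trans (rdot_le _) _.
apply: (@le_trans _ _ (eps / L * rnorm (scal_real sk h *: e) * rnorm u)).
  by rewrite ler_wpM2r ?rnorm_ge0.
rewrite rnormZ.
have -> : eps / L * (`|h| * rnorm e) * rnorm u =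
          `|h| * (eps * (rnorm e * rnorm u / L)) by field; rewrite gt_eqF.
by rewrite ler_wpM2l// ler_piMr ?(ltW eps0)// ler_pdivrMr// mul1r /L lerDl.
Qed.

(** Integration of 1 - s^p is replaced by the mean value theorem for [g], the pairing minus a
    primitive of its bound: [dg] is nonpositive, and the integral of 1 - s^p over [0, 1] is p / (p +
    1). *)
Lemma mean_value_powR (a e : X) F (l : Y) (u : Y) (c p : R) : 0 < p ->
  (forall s : R, 0 <= s <= 1 -> differentiable F (a + scal_real sk s *: e)) ->
  (forall s : R, 0 <= s <= 1 ->
     rdot ('d F (a + scal_real sk s *: e) e - l) u <= c * (1 - s `^ p)) ->
  rdot (F (a + e) - F a - l) u <= c * (p / (p + 1)).
Proof.
move=> p0 dF bF; have p1 : 0 < p + 1 by lra.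
pose f (s : R) : R := rdot (F (a + scal_real sk s *: e)) u.
pose g (s : R) : R := f s - (rdot l u + c) * s + c / (p + 1) * s `^ (p + 1).
pose dg (s : R) : R := rdot ('d F (a + scal_real sk s *: e) e) u
  - (rdot l u + c) + c * s `^ p.
have df (s : R) : 0 <= s <= 1 -> is_derive s (1 : R^o) f
    (rdot ('d F (a + scal_real sk s *: e) e) u).
  by move=> s01; apply: is_derive_rdot_line; exact: dF.
have gder (s : R) : 0 < s <= 1 -> is_derive s (1 : R^o) g (dg s).
  move=> /andP[s0 s1].
  have /df df_s : 0 <= s <= 1 by rewrite ltW.
  have dpow := @is_derive1_powR R (p + 1) s s0.
  rewrite /g /dg; apply: is_derive_eq.
  rewrite /GRing.scale /= addrK mulr1; congr (_ + _).
  by rewrite mulrA divfK// gt_eqF.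
have gcont (s : R) : 0 < s <= 1 -> {for s, continuous g}.
  move=> /gder dgs; apply: differentiable_continuous.
  by apply/derivable1_diffP; apply: ex_derive.
(* The derivative of the power is available for s > 0 only; at 0, right continuity of [g] is
   assembled term by term. *)
have f0 : f @ 0^'+ --> f 0.
  apply: cvg_at_right_filter; apply: differentiable_continuous.
  apply/derivable1_diffP; have /df H : 0 <= (0 : R) <= 1 by rewrite lexx ler01.
  exact: ex_derive.
have [s s01] : exists2 s, s \in `]0, 1[%R & g 1 - g 0 = dg s * (1 - 0).
  apply: MVT => //.
    by move=> s; rewrite in_itv /= => /andP[s0 s1]; apply: gder; rewrite s0 ltW.
  apply/continuous_within_itvP => //; split.
  - by move=> s; rewrite in_itv /= => /andP[s0 s1]; apply: gcont; rewrite s0 ltW.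
  - have -> : g 0 = f 0 - (rdot l u + c) * 0 + c / (p + 1) * 0.
      by rewrite /g powR0 ?gt_eqF.
    apply: cvgD; last by apply: cvgM; [exact: cvg_cst|exact: powR_cvg0].
    apply: cvgB => //; apply: cvgM; first exact: cvg_cst.
    exact: cvg_at_right_filter.
  - by apply: cvg_at_left_filter; apply: gcont; rewrite ltr01 lexx.
move: s01; rewrite in_itv /= => /andP[s0 s1].
have /bF : 0 <= s <= 1 by rewrite !ltW.
rewrite /g /dg /f powR1 powR0 ?gt_eqF// scal_real1 scal_real0 scale0r scale1r addr0.
rewrite !rdotBl => H1 H2.
have -> : c * (p / (p + 1)) = c - c / (p + 1) by field; rewrite gt_eqF.
lra.
Qed.

End MeanValue.

(** * The scalar majorizing sequence *)

Section Majorant.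
Context (R : realType) (K p vtheta w1 w2 : R).
Hypotheses (K0 : 0 < K) (p0 : 0 < p) (vtheta0 : 0 <= vtheta) (w20 : 0 <= w2)
  (w21 : w2 < w1) (w1vtheta : w1 * vtheta + w2 < 1).

Let radius : R := ((1 - w1 * vtheta - w2) * (p + 1) /
  (K * (1 - w1 * vtheta - w2 + p * (1 + w1 - w2)))) `^ p^-1.

(** The ratio t_{k+1} / t_k as a function of s = K t_k^p. *)
Definition contraction_factor (s : R) : R :=
  (1 + vtheta) * w1 * p * s / ((p + 1) * (1 - s)) + (w1 * vtheta + w2).

Let w10 : 0 < w1. Proof. exact: le_lt_trans w20 w21. Qed.
Let coef0 : 0 < (1 + vtheta) * w1 * p.
Proof. by rewrite !mulr_gt0// ltr_wpDr. Qed.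

Let D0 : 0 < 1 - w1 * vtheta - w2 + p * (1 + w1 - w2).
Proof.
have : 0 < p * (1 + w1 - w2).
  by rewrite mulr_gt0// -addrA addr_gt0// subr_gt0.
by move: w1vtheta; lra.
Qed.

Lemma lt_radius_powR (t : R) : 0 <= t -> t < radius ->
  K * t `^ p * (1 - w1 * vtheta - w2 + p * (1 + w1 - w2)) <
  (1 - w1 * vtheta - w2) * (p + 1).
Proof.
move=> t0; rewrite /radius; set b := (X in X `^ _) => tb.
have b0 : 0 <= b.
  by rewrite /b divr_ge0 ?mulr_ge0 ?(ltW D0) ?(ltW K0)//; move: w1vtheta p0; lra.
have : t `^ p < b.
  have : t `^ p < (b `^ p^-1) `^ p by rewrite gt0_ltr_powR ?nnegrE ?powR_ge0.
  by rewrite -powRrM mulVf ?gt_eqF// powRr1.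
by rewrite /b ltr_pdivlMr ?mulr_gt0// mulrCA mulrA.
Qed.

(** The factor in [D0] exceeds (1 - w1 vtheta - w2) (p + 1) by (1 + vtheta) w1 p > 0, so s >= 1
    contradicts [lt_radius_powR]. *)
Lemma lt_radius_lt1 (t : R) : 0 <= t -> t < radius -> K * t `^ p < 1.
Proof.
move=> t0 /(lt_radius_powR t0); set s := K * t `^ p => H.
rewrite ltNge; apply/negP => s1.
have H1 := ler_wpM2r (ltW D0) s1.
by move: coef0; lra.
Qed.

(** Once the denominator (p + 1) (1 - s) is cleared, the claim is the inequality of
    [lt_radius_powR]; this is where the radius comes from. *)
Lemma contraction_factor_lt1 (t : R) : 0 <= t -> t < radius ->
  contraction_factor (K * t `^ p) < 1.
Proof.
move=> t0 tr; have := lt_radius_powR t0 tr; have := lt_radius_lt1 t0 tr.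
rewrite /contraction_factor; set s := K * t `^ p => s1 H.
have p1 : 0 < p + 1 by rewrite addr_gt0.
rewrite -ltrBrDr ltr_pdivrMr ?mulr_gt0 ?subr_gt0//; lra.
Qed.

Lemma le_contraction_factor (s1 s2 : R) : 0 <= s1 -> s1 <= s2 -> s2 < 1 ->
  contraction_factor s1 <= contraction_factor s2.
Proof.
move=> s10 s12 s21; rewrite /contraction_factor lerD2r.
have p1 : 0 < p + 1 by rewrite addr_gt0.
have d1 : 0 < (p + 1) * (1 - s1) by rewrite mulr_gt0//; lra.
have d2 : 0 < (p + 1) * (1 - s2) by rewrite mulr_gt0//; lra.
apply: ler_pM; rewrite ?mulr_ge0 ?invr_ge0 ?(ltW d1) ?(ltW w10) ?(ltW p0) ?addr_ge0//.
  by rewrite ler_wpM2l// ltW.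
by rewrite lef_pV2 ?posrE// ler_pM2l// lerD2l lerN2.
Qed.

Lemma contraction_factor_gt0 (s : R) : 0 < s < 1 -> 0 < contraction_factor s.
Proof.
move=> /andP[s0 s1]; rewrite ltr_wpDr ?addr_ge0 ?mulr_ge0 ?(ltW w10)//.
rewrite divr_gt0 ?(mulr_gt0 coef0)// mulr_gt0 ?subr_gt0//.
by rewrite addr_gt0.
Qed.

Lemma contraction_factor_ge0 (s : R) : 0 <= s < 1 -> 0 <= contraction_factor s.
Proof.
move=> /andP[s0 s1]; apply: addr_ge0; last first.
  by rewrite addr_ge0// mulr_ge0// ltW.
rewrite divr_ge0 ?(mulr_ge0 (ltW coef0))// mulr_ge0 ?subr_ge0 ?(ltW s1)//.
by rewrite addr_ge0// ltW.
Qed.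

Lemma contraction_factorE (t : R) : 0 <= t ->
  (1 + vtheta) * w1 * p * K * t `^ (p + 1) / ((p + 1) * (1 - K * t `^ p))
    + (w1 * vtheta + w2) * t = contraction_factor (K * t `^ p) * t.
Proof.
move=> t0; rewrite /contraction_factor powRD ?powRr1//; last first.
  by rewrite gt_eqF// addr_gt0.
by rewrite [RHS]mulrDl; congr (_ + _); rewrite [RHS]mulrAC !mulrA.
Qed.

(** The ratio increases with the term, so along the sequence it never exceeds its initial value q <
    1, and the decay is geometric. *)
Lemma majorant_sequence (t : nat -> R) : 0 < t 0%N < radius ->
  (forall k, 0 <= t k -> 1 - K * t k `^ p != 0 ->
     t k.+1 = (1 + vtheta) * w1 * p * K * t k `^ (p + 1) /
                ((p + 1) * (1 - K * t k `^ p))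
              + (w1 * vtheta + w2) * t k) ->
  [/\ forall k, 0 < t k <= t 0%N,
      forall k, t k.+1 = contraction_factor (K * t k `^ p) * t k,
      forall k, t k.+1 < t k & t @ \oo --> 0].
Proof.
move=> /andP[t00 t0r] trec; set q := contraction_factor (K * t 0%N `^ p).
have q1 : q < 1 by rewrite contraction_factor_lt1// ltW.
have Kt (u : R) : 0 < u <= t 0%N -> 0 < K * u `^ p <= K * t 0%N `^ p.
  move=> /andP[u0 ut]; rewrite mulr_gt0 ?powR_gt0//= ler_pM2l//.
  by rewrite ge0_ler_powR ?nnegrE// ltW.
have Kt01 : K * t 0%N `^ p < 1 by rewrite lt_radius_lt1// ltW.
(* The recurrence is conditional on a nonzero denominator, so membership in (0, t_0] has to be known
   before it is applied. *)
have step k : 0 < t k <= t 0%N ->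
    t k.+1 = contraction_factor (K * t k `^ p) * t k.
  move=> tk; have /andP[s0 s1] := Kt _ tk; case/andP: tk => tk0 tkt.
  rewrite trec ?contraction_factorE ?(ltW tk0)//.
  by rewrite gt_eqF// subr_gt0 (le_lt_trans s1).
have stepq k : 0 < t k <= t 0%N -> 0 < t k.+1 <= q * t k.
  move=> tk; have /andP[s0 s1] := Kt _ tk; rewrite (step _ tk); case/andP: tk => tk0 tkt.
  have s1' := le_lt_trans s1 Kt01.
  rewrite mulr_gt0 ?contraction_factor_gt0 ?s0//=.
  by rewrite ler_pM2r// le_contraction_factor// ltW.
have tin k : 0 < t k <= t 0%N.
  elim: k => [|k IH]; first by rewrite t00 lexx.
  have /andP[-> H] := stepq _ IH; case/andP: IH => tk0 tkt.
  by rewrite (le_trans H)// (le_trans _ tkt)// ler_piMl ?ltW.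
have q0 : 0 <= q.
  by rewrite ltW// contraction_factor_gt0// Kt01 mulr_gt0 ?powR_gt0.
split=> // k.
- exact: step.
- have /andP[_ H] := stepq _ (tin k); apply: le_lt_trans H _.
  by have /andP[tk0 _] := tin k; rewrite gtr_pMl.
have tq n : t n <= t 0%N * q ^+ n.
  elim: n => [|n IH]; first by rewrite expr0 mulr1.
  have /andP[_ H] := stepq _ (tin n); apply: le_trans H _.
  by rewrite exprS mulrCA ler_wpM2l.
apply: (@squeeze_cvgr _ _ _ _ (cst 0) (geometric (t 0%N) q)).
- by apply: nearW => n; rewrite /= tq andbT; have /andP[/ltW] := tin n.
- exact: cvg_cst.
- by apply: cvg_geometric; rewrite ger0_norm.
Qed.

End Majorant.

(** * Algebra of one inexact step *)

Section Step.
Context (R : realType) (sk : scalar_kind).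
Implicit Types (X Y Z : hilbertSpace R sk).

Lemma invertible_op_comp X Y Z (A : X -> Y) (B : Y -> Z) :
  invertible_op A -> invertible_op B -> invertible_op (B \o A).
Proof.
move=> iA iB; have [cA' AK A'K] := invertible_invop iA.
have [cB' BK B'K] := invertible_invop iB.
split; first exact: continuous_linear_comp iA.1 iB.1.
exists (invop A \o invop B); split; first exact: continuous_linear_comp.
- exact: can_comp.
- exact: can_comp.
Qed.

(* The preconditioned residual condition controls N^-1 r, for N = A^* A:
   N^-1 r = (P N)^-1 (P r) and A^* y = N (A^+ y). *)
Lemma residual_bound X Y (A : X -> Y) (P : X -> X) (theta vtheta : R)
    (res : X) (y : Y) :
  invertible_op (normal_op A) -> invertible_op P -> 0 <= vtheta ->
  rnorm (P res) <= theta * rnorm (P (adjoint A y)) ->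
  theta * condn (P \o normal_op A) <= vtheta ->
  rnorm (invop (normal_op A) res) <= vtheta * rnorm (mp_inverse A y).
Proof.
move=> iN iP vtheta0 resP cond; have iPN := invertible_op_comp iN iP.
have [cPN' PNK PN'K] := invertible_invop iPN; have [_ NK N'K] := invertible_invop iN.
set w := mp_inverse A y.
have -> : invop (normal_op A) res = invop (P \o normal_op A) (P res).
  by rewrite -{2}(N'K res) -[P _]/((P \o normal_op A) _) PNK.
apply: le_trans (opnorm_bound cPN' _) _.
apply: le_trans (ler_wpM2l (opnorm_ge0 _) resP) _.
rewrite -normal_op_mp_inverse// -[P (normal_op A _)]/((P \o normal_op A) _) -/w.
(* For negative [theta] the quantity to be bounded is at most 0. *)
have [theta0|theta0] := leP 0 theta; last first.
  apply: (@le_trans _ _ 0); last by rewrite mulr_ge0// rnorm_ge0.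
  by rewrite mulr_ge0_le0 ?opnorm_ge0// mulr_le0_ge0 ?rnorm_ge0// ltW.
apply: (@le_trans _ _ (theta * condn (P \o normal_op A) * rnorm w)); last first.
  by rewrite ler_wpM2r ?rnorm_ge0.
rewrite /condn mulrCA -!mulrA ler_wpM2l// ler_wpM2l ?opnorm_ge0//.
exact: (opnorm_bound iPN.1).
Qed.

(** The residual contributes at most w1 vtheta |A^+ y|, and A^+ y = e - d with d = A^+ (A e - y). It
    therefore enters both terms, giving the factor 1 + vtheta in one and w1 vtheta in the other. *)
Lemma gauss_newton_step_bound X Y (A : X -> Y) (B P : X -> X)
    (theta vtheta w1 w2 : R) (res s e : X) (y : Y) :
  continuous_linear A -> invertible_op (normal_op A) ->
  invertible_op B -> invertible_op P -> 0 <= vtheta ->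
  opnorm (invop B \o normal_op A) <= w1 ->
  opnorm (fun v => invop B (normal_op A v) - v) <= w2 ->
  rnorm (P res) <= theta * rnorm (P (adjoint A y)) ->
  theta * condn (P \o normal_op A) <= vtheta ->
  B s = - adjoint A y + res ->
  rnorm (e + s) <= (1 + vtheta) * w1 * rnorm (mp_inverse A (A e - y))
                   + (w1 * vtheta + w2) * rnorm e.
Proof.
move=> cA iN iB iP vtheta0 bw1 bw2 resP cond Bs.
have [cB' BK B'K] := invertible_invop iB; have [_ NK N'K] := invertible_invop iN.
have w10 : 0 <= w1 by apply: le_trans bw1; exact: opnorm_ge0.
set M : X -> X := invop B \o normal_op A in bw1 *.
have cM : continuous_linear M by exact: continuous_linear_comp iN.1 cB'.
have cMp := mp_inverse_continuous_linear cA iN.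
set w := mp_inverse A y; set d := mp_inverse A (A e - y).
have wed : w = e - d.
  by rewrite /d (linear_funB cMp.1) mp_inverse_cancel// opprB addrC subrK.
set v := invop (normal_op A) res.
have -> : e + s = M d + M v - (M e - e).
  rewrite -(BK s) Bs (linear_funD cB'.1) (linear_funN cB'.1).
  rewrite -normal_op_mp_inverse// -/w -{1}(N'K res) -/v.
  rewrite -[invop B (normal_op A w)]/(M w) -[invop B (normal_op A v)]/(M v).
  rewrite wed (linear_funB cM.1) !opprB.
  by rewrite addrAC addrCA.
have Mle u : rnorm (M u) <= w1 * rnorm u.
  by apply: le_trans (opnorm_bound cM u) _; rewrite ler_wpM2r ?rnorm_ge0.
have Me : rnorm (M e - e) <= w2 * rnorm e.
  have cMI := continuous_linear_sub cM (continuous_linear_id X).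
  apply: le_trans (opnorm_bound cMI e) _.
  by rewrite ler_wpM2r ?rnorm_ge0.
have vw : rnorm v <= vtheta * rnorm w by exact: residual_bound resP cond.
have wle : rnorm w <= rnorm e + rnorm d by rewrite wed ler_rnormB.
have H1 := ler_rnormB (M d + M v) (M e - e).
have H2 := ler_rnormD (M d) (M v).
have H3 := Mle d; have H4 := Mle v.
have H5 := ler_wpM2l w10 vw.
have H6 := ler_wpM2l (mulr_ge0 w10 vtheta0) wle.
lra.
Qed.

End Step.

(** * Local error estimate at a point near the zero, and convergence of the iteration *)

Lemma sup_ball_subset (R : realType) (sk : scalar_kind) (X : hilbertSpace R sk)
    (Om : set X) (xs : X) (rho : R) : 0 < rho ->
  oball xs (sup [set s : R | 0 <= s < rho /\ oball xs s `<=` Om]) `<=` Om.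
Proof.
move=> rho0 y yk.
have ne : [set s : R | 0 <= s < rho /\ oball xs s `<=` Om] !=set0.
  exists 0; split; first by rewrite lexx.
  by move=> z; rewrite /oball /= ltNge rnorm_ge0.
have [s [_ sOm] ys] := sup_gt ne yk.
exact: sOm.
Qed.

(** The constant [beta] appears in the lower bound for F'(y) and multiplies the linearization error
    in its estimate, so it cancels in the product. *)
Lemma newton_error_bound (R : realType) (sk : scalar_kind)
    (X Y : hilbertSpace R sk) (F : X -> Y) (xs y : X) (beta K p : R) :
  0 < p -> 0 <= K -> 0 < beta -> F xs = 0 ->
  (forall v, rnorm v <= beta * rnorm ('d F xs v)) ->
  (forall s : R, 0 <= s <= 1 ->
     differentiable F (xs + scal_real sk s *: (y - xs))) ->
  (forall s : R, 0 <= s <= 1 ->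
     beta * opnorm (fun v : X =>
              'd F y v - 'd F (xs + scal_real sk s *: (y - xs)) v)
       <= K * (1 - s `^ p) * rnorm (y - xs) `^ p) ->
  K * rnorm (y - xs) `^ p < 1 ->
  continuous_linear ('d F y) /\
  invertible_op (normal_op ('d F y)) /\
  rnorm (mp_inverse ('d F y) ('d F y (y - xs) - F y)) <=
    p * K * rnorm (y - xs) `^ p / ((p + 1) * (1 - K * rnorm (y - xs) `^ p))
    * rnorm (y - xs).
Proof.
move=> p0 K0 beta0 Fxs bAs dF lipF Klt1.
set e := y - xs in lipF dF Klt1 *.
have p1 : 0 < p + 1 by rewrite addr_gt0.
have xe : xs + e = y by rewrite /e addrC subrK.
have xse : xs + scal_real sk 1 *: e = y by rewrite scal_real1 scale1r.
have dFy : differentiable F y by rewrite -xse; apply: dF; rewrite ler01 lexx.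
have cA := differentiable_continuous_linear dFy.
set A : X -> Y := 'd F y in cA *.
pose eta := rnorm e `^ p; have eta0 : 0 <= eta by exact: powR_ge0.
have lip (s : R) : 0 <= s <= 1 -> forall v,
    beta * rnorm (A v - 'd F (xs + scal_real sk s *: e) v) <=
    K * (1 - s `^ p) * eta * rnorm v.
  move=> s01 v; have cD := differentiable_continuous_linear (dF _ s01).
  have H := opnorm_bound (continuous_linear_sub cA cD) v.
  apply: le_trans (ler_wpM2l (ltW beta0) H) _.
  by rewrite mulrA ler_wpM2r ?rnorm_ge0// lipF.
have c0 : 0 < 1 - K * eta by rewrite subr_gt0.
pose C := beta / (1 - K * eta).
have C0 : 0 <= C by rewrite divr_ge0 ?ltW.
(* At s = 0 the condition gives |v| <= beta |F'(xs) v| <= beta |A v| + K eta |v|. *)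
have bA v : rnorm v <= C * rnorm (A v).
  rewrite /C mulrAC ler_pdivlMr//.
  have := lip 0; rewrite lexx ler01 powR0 ?gt_eqF// scal_real0 scale0r addr0 subr0 mulr1.
  move=> /(_ isT v) H.
  have H1 := ler_rnormB (A v) (A v - 'd F xs v).
  rewrite opprB addrC subrK in H1.
  have := ler_wpM2l (ltW beta0) H1; have := bAs v; lra.
have iN := bounded_below_normal_op_invertible cA C0 bA.
split=> //; split=> //.
have bMp := mp_inverse_norm_bound cA C0 bA.
set E := A e - F y.
have betaE : beta * rnorm E <= K * eta * rnorm e * (p / (p + 1)).
  have [E0|/eqP/rnorm_gt0 E0] := eqVneq E 0.
    rewrite E0 rnorm0 mulr0 mulr_ge0 ?divr_ge0 ?(ltW p0) ?(ltW p1)//.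
    by rewrite !mulr_ge0 ?rnorm_ge0.
  rewrite -(ler_pM2r E0) -[X in X <= _]mulrA -expr2 -rdotxx.
  (* Since [F xs] is 0, -E is the linearization error; pairing it with itself reduces its norm to
     the scalar mean value inequality. *)
  have -> : rdot E E = rdot (F (xs + e) - F xs - A e) (- E).
    by rewrite xe Fxs subr0 rdotNr -rdotNl opprB.
  rewrite -ler_pdivlMl//.
  have -> : beta^-1 * (K * eta * rnorm e * (p / (p + 1)) * rnorm E) =
     (beta^-1 * (K * eta * rnorm e * rnorm E)) * (p / (p + 1)).
    by field; rewrite !gt_eqF.
  apply: mean_value_powR => // s s01.
  apply: le_trans (rdot_CauchySchwarz _ _) _; rewrite rnormN rnormC.
  rewrite -(ler_pM2l beta0) mulrA.
  apply: le_trans (ler_wpM2r (rnorm_ge0 E) (lip _ s01 e)) _.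
  rewrite le_eqVlt; apply/orP; left; apply/eqP.
  by field; rewrite gt_eqF.
apply: le_trans (bMp E) _; rewrite /C mulrAC.
have -> : p * K * eta / ((p + 1) * (1 - K * eta)) * rnorm e =
    K * eta * rnorm e * (p / (p + 1)) / (1 - K * eta).
  by field; rewrite !gt_eqF.
by rewrite ler_wpM2r// invr_ge0 ltW.
Qed.

Theorem theorem12 (R : realType) (sk : scalar_kind) (X Y : hilbertSpace R sk)
  (Om : set X) (F : X -> Y) (xs : X) (rho K p vtheta w1 w2 : R)
  (beta kappa r : R) (x0 : X)
  (B : X -> X -> X) (P : nat -> X -> X) (theta : nat -> R)
  (res s x : nat -> X) (t : nat -> R) :
  open Om ->
  continuously_differentiable_on Om F ->
  (forall y, Om y -> closed (range ('d F y))) ->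
  Om xs -> 0 < rho ->
  beta = opnorm (mp_inverse ('d F xs)) ->
  kappa = sup [set s : R | 0 <= s < rho /\ oball xs s `<=` Om] ->
  F xs = 0 ->
  injective ('d F xs) ->
  0 < K -> 0 < p <= 1 ->
  (forall (y : X) (tau : R), oball xs kappa y -> 0 <= tau <= 1 ->
     beta * opnorm (fun v : X =>
              'd F y v - 'd F (xs + scal_real sk tau *: (y - xs)) v)
       <= K * (1 - tau `^ p) * rnorm (y - xs) `^ p) ->
  0 <= vtheta < 1 -> 0 <= w2 < w1 -> w1 * vtheta + w2 < 1 ->
  r = Num.min kappa
        (((1 - w1 * vtheta - w2) * (p + 1) /
          (K * (1 - w1 * vtheta - w2 + p * (1 + w1 - w2)))) `^ p^-1) ->
  oball xs r x0 -> x0 <> xs ->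
  (* the inexact Gauss-Newton like method: what is required at step k presupposes
     that the step can be performed *)
  x 0%N = x0 ->
  (forall k, admissible Om F (x k) ->
     x k.+1 = x k + s k /\
     B (x k) (s k) = - adjoint ('d F (x k)) (F (x k)) + res k) ->
  (forall k, admissible Om F (x k) ->
     [/\ invertible_op (B (x k)),
         opnorm (invop (B (x k)) \o normal_op ('d F (x k))) <= w1 &
         opnorm (fun v : X =>
                   invop (B (x k)) (normal_op ('d F (x k)) v) - v) <= w2]) ->
  (forall k, admissible Om F (x k) ->
     [/\ invertible_op (P k),
         rnorm (P k (res k))
           <= theta k * rnorm (P k (adjoint ('d F (x k)) (F (x k)))) &
         0 <= theta k * condn (P k \o normal_op ('d F (x k))) <= vtheta]) ->
  (* the scalar sequence, likewise *)
  t 0%N = rnorm (x0 - xs) ->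
  (forall k, 0 <= t k -> 1 - K * t k `^ p != 0 ->
     t k.+1 = (1 + vtheta) * w1 * p * K * t k `^ (p + 1) /
                ((p + 1) * (1 - K * t k `^ p))
              + (w1 * vtheta + w2) * t k) ->
  (* well-definedness *)
  (forall k, admissible Om F (x k) /\
     exists! z : X, B (x k) z = - adjoint ('d F (x k)) (F (x k)) + res k) /\
  (forall k, 0 <= t k /\ 1 - K * t k `^ p != 0) /\
  (* behaviour of t *)
  decreasing_seq t /\
  (forall k, 0 < t k < r) /\
  t @ \oo --> (0 : R) /\
  (* behaviour of x *)
  (forall k, oball xs r (x k)) /\
  x @ \oo --> xs /\
  (forall k, rnorm (x k.+1 - xs)
     <= (1 + vtheta) * w1 * p * K / ((p + 1) * (1 - K * rnorm (x0 - xs) `^ p))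
          * rnorm (x k - xs) `^ (p + 1)
        + (w1 * vtheta + w2) * rnorm (x k - xs)) /\
  (forall k, rnorm (x k - xs) <= t k).
Proof.
move=> openOm contF clF Omxs rho0 betaE kappaE Fxs injF K0 /andP[p0 p1] lipF.
move=> /andP[vtheta0 _] /andP[w20 w21] w1vtheta rE x0r x0xs xE iter BP PP tE trec.
have kappaOm : oball xs kappa `<=` Om by rewrite kappaE; exact: sup_ball_subset.
have cAs := differentiable_continuous_linear (contF _ Omxs).1.
have bAs v : rnorm v <= beta * rnorm ('d F xs v).
  by rewrite betaE; apply: rnorm_le_opnorm_mp_inverse => //; exact: clF.
have e00 : 0 < rnorm (x0 - xs).
  by apply: rnorm_gt0 => /eqP; rewrite subr_eq0 => /eqP.
(* Positivity of [beta] is seen on the nonzero vector x0 - xs. *)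
have beta0 : 0 < beta.
  have H := bAs (x0 - xs); rewrite ltNge; apply/negP => b0.
  have := mulr_le0_ge0 b0 (rnorm_ge0 ('d F xs (x0 - xs))); lra.
have w10 : 0 < w1 by exact: le_lt_trans w20 w21.
pose radius : R := ((1 - w1 * vtheta - w2) * (p + 1) /
  (K * (1 - w1 * vtheta - w2 + p * (1 + w1 - w2)))) `^ p^-1.
have r_kappa (u : R) : u < r -> u < kappa by rewrite rE lt_min => /andP[].
have r_radius (u : R) : u < r -> u < radius by rewrite rE lt_min => /andP[].
have t0r : 0 < t 0%N < radius by rewrite tE e00 r_radius.
have [tin tS tdec tcvg] := majorant_sequence K0 p0 vtheta0 w20 w21 w1vtheta t0r trec.
have tr k : 0 < t k < r.
  by have /andP[-> tk] := tin k; rewrite (le_lt_trans tk)// tE.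
have Kt (u v : R) : 0 <= u -> u <= v -> K * u `^ p <= K * v `^ p.
  by move=> u0 uv; rewrite ler_pM2l// ge0_ler_powR ?nnegrE ?(ltW p0)// (le_trans u0).
have K1 (u : R) : 0 <= u -> u < r -> K * u `^ p < 1.
  by move=> u0 /r_radius; exact: (lt_radius_lt1 K0 p0 vtheta0 w20 w21 w1vtheta).
have local y : oball xs r y ->
    admissible Om F y /\
    rnorm (mp_inverse ('d F y) ('d F y (y - xs) - F y)) <=
    p * K * rnorm (y - xs) `^ p / ((p + 1) * (1 - K * rnorm (y - xs) `^ p))
    * rnorm (y - xs).
  move=> yr; have yk : oball xs kappa y by exact: r_kappa.
  have Omy := kappaOm _ yk.
  have seg (tau : R) : 0 <= tau <= 1 ->
      differentiable F (xs + scal_real sk tau *: (y - xs)).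
    move=> /andP[tau0 tau1]; apply: (contF _ _).1; apply: kappaOm.
    rewrite /oball /= [xs + _]addrC addrK rnormZ ger0_norm//.
    by apply: le_lt_trans yk; rewrite ler_piMl ?rnorm_ge0.
  have lip (tau : R) (tau01 : 0 <= tau <= 1) := lipF y tau yk tau01.
  have y1 := K1 _ (rnorm_ge0 _) yr.
  have [_ [iN err]] := newton_error_bound p0 (ltW K0) beta0 Fxs bAs seg lip y1.
  by split.
have step k : oball xs r (x k) ->
    rnorm (x k.+1 - xs) <=
    contraction_factor p vtheta w1 w2 (K * rnorm (x k - xs) `^ p) * rnorm (x k - xs).
  move=> xr; have [adm err] := local _ xr; have [xS Bs] := iter _ adm.
  have [iB bw1 bw2] := BP _ adm; have [iP resP /andP[_ cond]] := PP _ adm.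
  have cA := differentiable_continuous_linear (contF _ adm.1).1.
  have -> : x k.+1 - xs = (x k - xs) + s k by rewrite xS addrAC.
  have := gauss_newton_step_bound (x k - xs) cA adm.2 iB iP vtheta0 bw1 bw2 resP cond Bs.
  move/le_trans; apply; rewrite /contraction_factor [leRHS]mulrDl lerD2r.
  have w : 0 <= (1 + vtheta) * w1 by rewrite mulr_ge0 ?addr_ge0// ltW.
  apply: le_trans (ler_wpM2l w err) _.
  by rewrite !mulrA.
(* By induction the iterate stays in the ball of radius [r], which makes the conditional hypotheses
   at step [k] available; monotonicity of the contraction factor then transfers the bound to [t]. *)
have main k : rnorm (x k - xs) <= t k.
  elim: k => [|k IH]; first by rewrite xE tE.
  have /andP[tk0 tkr] := tr k.
  have xr : oball xs r (x k) by exact: le_lt_trans tkr.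
  apply: le_trans (step _ xr) _; rewrite tS.
  apply: ler_pM; rewrite ?rnorm_ge0//; last first.
    apply: le_contraction_factor => //; rewrite ?mulr_ge0 ?powR_ge0 ?(ltW K0)//.
      by apply: Kt => //; exact: rnorm_ge0.
    by apply: K1 => //; exact: ltW.
  apply: (contraction_factor_ge0 p0 vtheta0 w20 w21).
  by rewrite mulr_ge0 ?powR_ge0 ?(ltW K0)//= K1 ?rnorm_ge0.
have xr k : oball xs r (x k).
  by have /andP[_ tkr] := tr k; exact: le_lt_trans tkr.
split.
  move=> k; have [adm _] := local _ (xr k); split=> //.
  have [/invertible_invop[_ BK B'K] _ _] := BP _ adm.
  by exists (invop (B (x k)) (- adjoint ('d F (x k)) (F (x k)) + res k));
    split=> [|z <-]; rewrite ?BK.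
split.
  move=> k; have /andP[tk0 tkr] := tr k; split; first exact: ltW.
  by rewrite gt_eqF// subr_gt0 K1// ltW.
split; first exact/decreasing_seqP.
split=> //; split=> //; split=> //; split.
  apply/cvg_rnormP => d d0; move/cvgrPdist_lt: tcvg => /(_ d d0).
  apply: filterS => k; rewrite sub0r normrN => /(le_lt_trans (ler_norm _)).
  exact: le_lt_trans.
split=> // k; apply: le_trans (step _ (xr k)) _.
(* Only the denominator remains to be compared: |x_k - xs| <= t_k <= t_0 shows that it is smallest
   at k = 0. *)
rewrite -contraction_factorE ?rnorm_ge0// lerD2r mulrAC.
have ek0 : rnorm (x k - xs) <= rnorm (x0 - xs).
  by rewrite (le_trans (main k))// -tE; have /andP[] := tin k.
have p10 : 0 < p + 1 by rewrite addr_gt0.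
have d0 : 0 < 1 - K * rnorm (x0 - xs) `^ p by rewrite subr_gt0 K1// ltW.
have dk : 1 - K * rnorm (x0 - xs) `^ p <= 1 - K * rnorm (x k - xs) `^ p.
  by rewrite lerD2l lerN2 Kt ?rnorm_ge0.
rewrite ler_wpM2r ?powR_ge0// ler_wpM2l ?mulr_ge0 ?addr_ge0 ?(ltW w10) ?(ltW p0) ?(ltW K0)//.
by rewrite lef_pV2 ?posrE ?(mulr_gt0 p10) ?(lt_le_trans d0 dk)// ler_pM2l.
Qed.
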